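(* Assume that the affine root system $\Phi^v$ is of untwisted affine ADE type, i.e. the untwisted affinization of a finite root system of type $A$, $D$ or $E$. Let $\lambda,\nu\in P$ be dominant coweights of positive level. Then the set $\mathcal{H}^{\lambda,\nu}_{I_\infty}$ of spherical $I_\infty$-Hecke paths of shape $\lambda$ and endpoint $\nu$ (defined in the context) is a finite set.
   Context: Root data. Let $\mathbf{G}$ be a split untwisted affine Kac-Moody group. Let $P$ be its cocharacter lattice (elements are called coweights), $\mathbb{A}=P\otimes_{\mathbb{Z}}\mathbb{R}$, $\Phi^v$ its set of real roots, $\Phi^{v,\pm}$ the positive/negative real roots (write $\beta>0$ or $\beta<0$), $\beta^\vee$ the coroot of $\beta$, $\langle\cdot,\cdot\rangle$ the pairing between roots and coweights, and $W^v$ the Weyl group, generated by the reflections $s_\beta$, $\beta\in\Phi^v$. The level of $\lambda\in\mathbb{A}$ is its pairing with the minimal positive imaginary root. A coweight $\lambda$ is dominant if it pairs non-negatively with all positive roots. The open Tits cone consists exactly of the elements of positive level. Affine Weyl group. Let $W=W^v\ltimes Q^\vee$, where $Q^\vee\subset P$ is the coroot lattice, and write the translation by $\mu$ as $\pi^\mu$. The element $w\pi^\mu$ acts on $\mathbb{A}$ by $w\pi^\mu.x=w(x)+w(\mu)$. Affine roots. $\Phi=\{\beta+n\pi\mid\beta\in\Phi^v,\ n\in\mathbb{Z}\}$ (with $\pi$ a formal symbol), $\Phi^+=\{\beta+n\pi\in\Phi\mid n>0\text{ or }(n=0\text{ and }\beta>0)\}$ and $\Phi^-=-\Phi^+$.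 The group $W$ acts on $\Phi$ by $w(\beta+n\pi)=w(\beta)+n\pi$ for $w\in W^v$ and $\pi^\mu(\beta+n\pi)=\beta+(n+\langle\mu,\beta\rangle)\pi$. The reflection attached to $\gamma=\pm(\beta+n\pi)$ with $\beta>0$ is $s_\gamma=\pi^{n\beta^\vee}s_\beta\in W$. Local data along the segment from $0$ to $\lambda$. For $x\in\mathbb{A}$ put $\Phi_x=\{\gamma\in\Phi\mid s_\gamma.x=x\}$ and $\Phi_x^\pm=\Phi_x\cap\Phi^\pm$. Let $W_x\subset W$ be the subgroup generated by $\{s_\gamma\mid\gamma\in\Phi_x\}$; it is a Coxeter group with root system $\Phi_x$ and positive system $\Phi_x^+$. For $t\in[0,1]$ write $\Phi_t=\Phi_{t\lambda}$, $\Phi_t^\pm=\Phi_{t\lambda}^\pm$, $W_t=W_{t\lambda}$; in particular $W_0=W^v$. Let $W_{[t,t+\epsilon)}\subset W_t$ be the subgroup generated by the $s_\gamma$ with $\gamma=\pm(\beta+n\pi)\in\Phi_t$ and $\langle\beta,\lambda\rangle=0$; it is a standard parabolic subgroup of $W_t$. Let $\leq_{W_t/W_{[t,t+\epsilon)}}$ be the Bruhat order on the parabolic quotient $W_t/W_{[t,t+\epsilon)}$ (the Bruhat order of $W_t$ restricted to minimal-length coset representatives). For $t\in(0,1)$ and $x\in W$ there is a unique $\overline{x}\in W_t$ (depending on $t$) such that $x^{-1}(\Phi^-)\cap\Phi_t=\overline{x}^{-1}(\Phi_t^-)$. $I_\infty$-Hecke paths. $\mathcal{H}^{\lambda,\nu}_{I_\infty}$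 is the set of piecewise linear paths $\tau:[0,1]\to\mathbb{A}$ for which there exist an integer $N\geq0$, folding times $0=t_0<t_1<\cdots<t_N<t_{N+1}=1$ and folding directions $x_0,\dots,x_N\in W$ with $x_0\in W_0=W^v$, such that $\tau(t)=x_k.(t\lambda)$ for $t\in[t_k,t_{k+1}]$, $0\leq k\leq N$, and such that: (i) $x_{k-1}^{-1}x_k\in W_{t_k}$ for $1\leq k\leq N$; (ii) (folding condition) $\overline{x_{k-1}}\leq_{W_{t_k}/W_{[t_k,t_k+\epsilon)}}\overline{x_{k-1}}\,x_{k-1}^{-1}x_k$ for $1\leq k\leq N$, where $\overline{x_{k-1}}\in W_{t_k}$ is defined with $t=t_k$; (iii) $x_N.\lambda=\nu$; (iv) (irredundancy) $x_{k-1}.\lambda\neq x_k.\lambda$ for $1\leq k\leq N$. *)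

(* Defs.v *)
From Stdlib Require Import Relation_Operators.
From mathcomp Require Import all_boot all_order all_algebra.
From mathcomp Require Import boolp classical_sets cardinality reals.

Set Implicit Arguments.
Unset Strict Implicit.
Unset Printing Implicit Defensive.

Import Order.TTheory GRing.Theory Num.Theory.
Local Open Scope classical_set_scope.
Local Open Scope ring_scope.

(** Convention for Cartan matrices: [A i j] is the pairing of the [j]-th simple
    root with the [i]-th simple coroot. *)

(** ** Finite type ADE and untwisted affinization *)

(** Diagram on the nodes 0, .., l-1: the nodes 0, .., l-2 form a chain, and the
    node l-1 is joined to the node b only.  It is of type A_l for b = l-2, of
    type D_l for b = l-3, and of type E_l for b = 2, l = 6, 7, 8. *)
Definition dynkin_edge (l b i j : nat) : bool :=
  (i < j)%N && (if j.+1 == l then i == b else j == i.+1).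

Definition simply_laced_cartan (l b : nat) : 'M[int]_l :=
  \matrix_(i < l, j < l)
    if i == j then 2
    else if dynkin_edge l b i j || dynkin_edge l b j i then -1 else 0.

Definition type_ADE (l : nat) (C : 'M[int]_l) : Prop :=
  [\/ (1 <= l)%N /\ C = simply_laced_cartan l (l - 2),
      (4 <= l)%N /\ C = simply_laced_cartan l (l - 3)
    | l \in [:: 6; 7; 8]%N /\ C = simply_laced_cartan l 2].

(** Roots of a finite root system, in coordinates over the simple roots. *)
Inductive finite_root (l : nat) (C : 'M[int]_l) : 'rV[int]_l -> Prop :=
| finite_root_simple i : finite_root C (delta_mx 0 i)
| finite_root_refl b i : finite_root C b ->
    finite_root C (b - (C *m b^T) i 0 *: delta_mx 0 i).

Definition highest_root (l : nat) (C : 'M[int]_l) (theta : 'rV[int]_l) : Prop :=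
  finite_root C theta /\
  forall b, finite_root C b -> forall i, b 0 i <= theta 0 i.

(** The additional simple root alpha_0 (index [lshift l 0]) pairs like -theta and
    its coroot like -theta^vee.  Since C is simply laced, theta^vee has the same
    coordinates over the simple coroots as theta over the simple roots. *)
Definition affinization (l : nat) (C : 'M[int]_l) (theta : 'rV[int]_l) :
    'M[int]_(1 + l) :=
  block_mx 2%:M (- (theta *m C)) (- (C *m theta^T)) C.

(** ** Root data of split Kac-Moody groups *)

(** The cocharacter lattice P is Z^r (columns), the character lattice is its
    dual (rows), and the pairing is the product of a row and a column. *)
Definition pairing (K : pzRingType) (r : nat) (b : 'rV[K]_r) (y : 'cV[K]_r) : K :=
  (b *m y) 0 0.

Record root_datum (n : nat) (A : 'M[int]_n) (r : nat) := RootDatum {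
  sroot : 'I_n -> 'rV[int]_r;
  scoroot : 'I_n -> 'cV[int]_r;
  pairing_simple : forall i j, pairing (sroot j) (scoroot i) = A i j;
  sroot_free : forall c : 'I_n -> int,
    \sum_i c i *: sroot i = 0 -> forall i, c i = 0;
  scoroot_free : forall c : 'I_n -> int,
    \sum_i c i *: scoroot i = 0 -> forall i, c i = 0
}.

Section RealRoots.
Variables (n : nat) (A : 'M[int]_n) (r : nat) (D : root_datum A r).

Inductive weyl : 'M[int]_r -> Prop :=
| weyl_one : weyl 1%:M
| weyl_step i w : weyl w -> weyl ((1%:M - scoroot D i *m sroot D i) *m w).

(** w in the Weyl group acts on coweights by y |-> w *m y, hence on roots by
    b |-> b *m invmx w. *)
Definition real_root : set 'rV[int]_r :=
  [set b | exists2 w, weyl w & exists i, b = sroot D i *m invmx w].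

Definition positive_root : set 'rV[int]_r :=
  [set b | real_root b /\
    exists c : 'I_n -> nat, b = \sum_i sroot D i *+ c i].

Definition negative_root : set 'rV[int]_r := [set b | positive_root (- b)].

Definition coroot (b : 'rV[int]_r) : 'cV[int]_r :=
  xget 0 [set y | exists2 w, weyl w &
    exists i, b = sroot D i *m invmx w /\ y = w *m scoroot D i].

Definition reflection (b : 'rV[int]_r) : 'M[int]_r := 1%:M - coroot b *m b.

Definition coroot_lattice : set 'cV[int]_r :=
  [set y | exists c : 'I_n -> int, y = \sum_i c i *: scoroot D i].

Definition dominant (y : 'cV[int]_r) : Prop :=
  forall b, positive_root b -> 0 <= pairing b y.

End RealRoots.

(** The minimal positive imaginary root is alpha_0 + theta. *)
Definition imaginary_root (l : nat) (C : 'M[int]_l) (theta : 'rV[int]_l) (r : nat)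
    (D : root_datum (affinization C theta) r) : 'rV[int]_r :=
  sroot D (lshift l 0) + \sum_(i < l) theta 0 i *: sroot D (rshift 1 i).

Definition level (l : nat) (C : 'M[int]_l) (theta : 'rV[int]_l) (r : nat)
    (D : root_datum (affinization C theta) r) (y : 'cV[int]_r) : int :=
  pairing (imaginary_root D) y.

(** ** The affine Weyl group and affine roots *)

(** The pair (w, mu) stands for w pi^mu. *)
Definition aff (r : nat) : Type := ('M[int]_r * 'cV[int]_r)%type.

Definition aone (r : nat) : aff r := (1%:M, 0).
Definition amul (r : nat) (x y : aff r) : aff r :=
  (x.1 *m y.1, invmx y.1 *m x.2 + y.2).
Definition ainv (r : nat) (x : aff r) : aff r := (invmx x.1, - (x.1 *m x.2)).
Definition atrans (r : nat) (mu : 'cV[int]_r) : aff r := (1%:M, mu).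
Definition alin (r : nat) (w : 'M[int]_r) : aff r := (w, 0).

Definition to_real (R : realType) (r : nat) (y : 'cV[int]_r) : 'cV[R]_r :=
  map_mx intr y.

Definition aact (R : realType) (r : nat) (x : aff r) (v : 'cV[R]_r) : 'cV[R]_r :=
  map_mx intr x.1 *m v + to_real R (x.1 *m x.2).

Inductive generated (r : nat) (S : set (aff r)) : aff r -> Prop :=
| generated_in x : S x -> generated S x
| generated_one : generated S (aone r)
| generated_mul x y : generated S x -> generated S y -> generated S (amul x y)
| generated_inv x : generated S x -> generated S (ainv x).

(** The pair (b, n) stands for b + n pi. *)
Definition affroot (r : nat) : Type := ('rV[int]_r * int)%type.

Definition ract (r : nat) (x : aff r) (g : affroot r) : affroot r :=
  (g.1 *m invmx x.1, g.2 + pairing g.1 x.2).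

Section Affine.
Variables (n : nat) (A : 'M[int]_n) (r : nat) (D : root_datum A r).

Definition affine_weyl : set (aff r) :=
  [set x | weyl D x.1 /\ coroot_lattice D x.2].

Definition affine_root : set (affroot r) := [set g | real_root D g.1].

Definition affine_pos : set (affroot r) :=
  [set g | affine_root g /\ (0 < g.2 \/ (g.2 = 0 /\ positive_root D g.1))].

Definition affine_neg : set (affroot r) :=
  [set g | affine_pos (- g.1, - g.2)].

(** The formula is invariant under g |-> -g, as coroot (- b) = - coroot b on
    real roots, so it needs no distinction on the sign of g.1. *)
Definition affine_refl (g : affroot r) : aff r :=
  amul (atrans (g.2 *: coroot D g.1)) (alin (reflection D g.1)).

Section Local.
Variables (R : realType) (x : 'cV[R]_r).

Definition Phi_at : set (affroot r) :=
  [set g | affine_root g /\ aact (affine_refl g) x = x].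
Definition Phi_at_pos : set (affroot r) := Phi_at `&` affine_pos.
Definition Phi_at_neg : set (affroot r) := Phi_at `&` affine_neg.

Definition W_at : set (aff r) := generated (affine_refl @` Phi_at).

(** The simple roots of the positive system [Phi_at_pos]: the positive roots g
    such that s_g permutes the other positive roots. *)
Definition simple_at : set (affroot r) :=
  [set g | Phi_at_pos g /\
    forall h, Phi_at_pos h -> h <> g -> Phi_at_pos (ract (affine_refl g) h)].

Definition word_at (s : seq (affroot r)) (u : aff r) : Prop :=
  (forall g, g \in s -> simple_at g) /\
  foldr (@amul r) (aone r) (map affine_refl s) = u.

Definition length_at (u : aff r) (k : nat) : Prop :=
  (exists2 s, word_at s u & size s = k) /\
  forall s, word_at s u -> (k <= size s)%N.

Definition bruhat_step (u v : aff r) : Prop :=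
  [/\ W_at u,
      exists2 g, Phi_at g & v = amul u (affine_refl g)
    & exists k m, [/\ length_at u k, length_at v m & (k < m)%N]].

Definition bruhat : aff r -> aff r -> Prop := clos_refl_trans (aff r) bruhat_step.

Definition minimal_rep (P : set (aff r)) (u m : aff r) : Prop :=
  (exists2 p, P p & m = amul u p) /\
  exists2 k, length_at m k &
    forall p j, P p -> length_at (amul u p) j -> (k <= j)%N.

(** For u, v in [W_at] and P a standard parabolic subgroup of [W_at]. *)
Definition quotient_le (P : set (aff r)) (u v : aff r) : Prop :=
  exists mu mv, [/\ minimal_rep P u mu, minimal_rep P v mv & bruhat mu mv].

(** y is the element of [W_at] written as z with a bar. *)
Definition is_bar (z y : aff r) : Prop :=
  W_at y /\ (ract z @^-1` affine_neg) `&` Phi_at = ract y @^-1` Phi_at_neg.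

End Local.

(** ** Hecke paths *)

Definition W_germ (R : realType) (lambda : 'cV[int]_r) (t : R) : set (aff r) :=
  generated (affine_refl @`
    [set g | Phi_at (t *: to_real R lambda) g /\ pairing g.1 lambda = 0]).

(** Paths are functions on [0, 1] only: no values outside are recorded.  The
    formulas on two consecutive closed intervals have to agree at the common
    end, so these paths are automatically continuous and piecewise linear. *)
Definition hecke_paths (R : realType) (lambda nu : 'cV[int]_r) :
    set ({s : R | 0 <= s <= 1} -> 'cV[R]_r) :=
  [set tau | exists (N : nat) (t : nat -> R) (x : nat -> aff r),
    let lam := to_real R lambda in
    [/\ [/\ t 0%N = 0, t N.+1 = 1 &
            forall k, (k <= N)%N -> t k < t k.+1],
        (forall k, (k <= N)%N -> affine_weyl (x k)) /\ (x 0%N).2 = 0,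
        forall k, (k <= N)%N -> forall s, t k <= sval s <= t k.+1 ->
          tau s = aact (x k) (sval s *: lam),
        aact (x N) lam = to_real R nu &
        forall k, (k < N)%N ->
          let d := amul (ainv (x k)) (x k.+1) in
          let p := t k.+1 *: lam in
          [/\ W_at p d,
              exists2 y, is_bar p (x k) y &
                quotient_le p (W_germ lambda (t k.+1)) y (amul y d)
            & aact (x k) lam <> aact (x k.+1) lam]]].

End Affine.

Arguments hecke_paths {n A r} D R lambda nu _.

(* Main.v *)
Require Import Defs.
From Stdlib Require Import Relation_Operators.
From mathcomp Require Import all_boot all_order all_algebra zify ring lra.
From mathcomp Require Import boolp classical_sets cardinality reals.

(** A folded path of shape [lambda] is recorded by its folding times together
    with the pairs (v, e), where v = w lambda is the direction and e = x.lambda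
    the endpoint that the path would have without further folds.  The folding
    condition unravels into reflections e' = e - m b^vee with m > 0 and
    k = <b, e> - m either positive, or zero with b > 0.  For the invariant form
    |e|^2 = |e'|^2 + 2 m k, so the norm never increases, and when it stays
    constant e' lies strictly below e in the coroot order.  Going backwards from
    nu, positivity of the level makes both kinds of predecessors finite in
    number: norms are bounded by |lambda|^2, the affine Cartan matrix is
    positive semidefinite with kernel spanned by the null root delta, and delta
    pairs positively with e.  Hence there are finitely many chains of pairs
    ending at nu, and each determines its folding times since m = (1 - t) <b, v>. *)

Set Implicit Arguments.
Unset Strict Implicit.
Unset Printing Implicit Defensive.

Import Order.TTheory GRing.Theory Num.Theory.
Local Open Scope classical_set_scope.
Local Open Scope ring_scope.

(** * The pairing and the bilinear form of a Cartan matrix *)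

Section Pairing.
Variables (K : comPzRingType) (r : nat).
Implicit Types (b : 'rV[K]_r) (y : 'cV[K]_r).

Lemma pairingE b y : pairing b y = \sum_i b 0 i * y i 0.
Proof. by rewrite /pairing mxE. Qed.

Lemma pairingDl b b' y : pairing (b + b') y = pairing b y + pairing b' y.
Proof. by rewrite /pairing mulmxDl mxE. Qed.

Lemma pairingDr b y y' : pairing b (y + y') = pairing b y + pairing b y'.
Proof. by rewrite /pairing mulmxDr mxE. Qed.

Lemma pairingZl k b y : pairing (k *: b) y = k * pairing b y.
Proof. by rewrite /pairing -scalemxAl mxE. Qed.

Lemma pairingZr k b y : pairing b (k *: y) = k * pairing b y.
Proof. by rewrite /pairing -scalemxAr mxE. Qed.

Lemma pairingNl b y : pairing (- b) y = - pairing b y.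
Proof. by rewrite -scaleN1r pairingZl mulN1r. Qed.

Lemma pairing_mulmx b y : b *m y = (pairing b y)%:M.
Proof. by rewrite [LHS]mx11_scalar. Qed.

Lemma mulmx_pairing (p : nat) (z : 'M[K]_(p, 1)) b y :
  z *m b *m y = pairing b y *: z.
Proof. by rewrite -mulmxA pairing_mulmx mul_mx_scalar. Qed.

Lemma pairing_mul (m : nat) (d : 'rV[K]_m) (M : 'M[K]_(m, r)) y :
  pairing (d *m M) y = pairing d (M *m y).
Proof. by rewrite /pairing mulmxA. Qed.

End Pairing.

Section Gram.
Variables (n : nat) (A : 'M[int]_n).
Implicit Types b c : 'rV[int]_n.

Definition gram b c : int := pairing b (A *m c^T).

Lemma gramDl b b' c : gram (b + b') c = gram b c + gram b' c.
Proof. exact: pairingDl. Qed.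

Lemma gramZl k b c : gram (k *: b) c = k * gram b c.
Proof. exact: pairingZl. Qed.

Lemma gramDr b c c' : gram b (c + c') = gram b c + gram b c'.
Proof. by rewrite /gram linearD mulmxDr pairingDr. Qed.

Lemma gramZr k b c : gram b (k *: c) = k * gram b c.
Proof. by rewrite /gram linearZ -scalemxAr pairingZr. Qed.

Lemma gramBr b c c' : gram b (c - c') = gram b c - gram b c'.
Proof. by rewrite gramDr -scaleN1r gramZr mulN1r. Qed.

Lemma gramBl b c c' : gram (c - c') b = gram c b - gram c' b.
Proof. by rewrite gramDl -scaleN1r gramZl mulN1r. Qed.

Hypothesis A_sym : A^T = A.

Lemma gramC b c : gram b c = gram c b.
Proof.
have -> : gram b c = (b *m (A *m c^T))^T 0 0 by rewrite mxE.
by rewrite !trmx_mul trmxK A_sym -mulmxA.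
Qed.

End Gram.

(** * Finiteness of integer boxes *)

Section Box.
Variable n : nat.

Lemma finite_box (M : int) :
  finite_set [set b : 'rV[int]_n | forall i, `|b 0 i| <= M].
Proof.
(* Shifting coordinates by |M| turns the interval from -|M| to |M| into an ordinal type. *)
pose g (d : 'rV['I_(2 * `|M|).+1]_n) : 'rV[int]_n :=
  \row_i ((d 0 i)%:Z - `|M|%:Z).
apply: (@sub_finite_set _ _ (g @` setT)); last first.
  by apply: finite_image; exact: finite_finset.
move=> b hb /=; exists (\row_i inord `|b 0 i + `|M|%:Z|) => //.
apply/rowP => i; rewrite !mxE inordK; have := hb i; lia.
Qed.

Lemma finite_int_box (M : int) : finite_set [set m : int | `|m| <= M].
Proof.
pose g (d : 'I_(2 * `|M|).+1) : int := d%:Z - `|M|%:Z.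
apply: (@sub_finite_set _ _ (g @` setT)); last first.
  by apply: finite_image; exact: finite_finset.
move=> b /= hb; exists (inord `|b + `|M|%:Z|) => //.
rewrite /g inordK; lia.
Qed.

End Box.

(** * Chains of folds and their finiteness *)

Section Chains.
Variables (R : realType) (n : nat) (A : 'M[int]_n) (eta : 'cV[int]_n).
Hypothesis A_sym : A^T = A.
Implicit Types b c u : 'rV[int]_n.

Notation gram := (gram A).

(* With [eta] the vector of pairings of the simple roots with [lambda], the row
   [c] stands for the coweight [lambda + \sum_i c_i alpha_i^vee]; then
   [height_at c b] is its pairing with the root with coordinates [b], and
   [energy c] is its norm minus that of [lambda]. *)
Definition height_at c b : int := pairing b eta + gram b c.

Definition energy c : int := 2 * pairing c eta + gram c c.

(** In the expanded square, m^2 [gram b b] = 2 m^2 joins the linear terms 2 m [height_at c b]. *)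
Lemma energyD c b m : gram b b = 2 ->
  energy (c + m *: b) = energy c + 2 * m * (height_at c b + m).
Proof.
move=> hb; rewrite /energy /height_at pairingDl pairingZl.
rewrite gramDl !gramDr !gramZl !gramZr hb (gramC A_sym c b); ring.
Qed.

Lemma height_atD c b m d :
  height_at (c + m *: d) b = height_at c b + m * gram b d.
Proof. by rewrite /height_at gramDr gramZr addrA. Qed.

(** Folds are read backwards: [c] is the endpoint after the fold, [c + m *: b] the one before. As
    [gram b b = 2], the number [height_at c b + m] is the height of [b] before the fold, minus m. *)
Definition fold_ok c b (m : int) : Prop :=
  [/\ gram b b = 2, 0 < m &
    0 < height_at c b + m \/ (height_at c b + m = 0 /\ forall i, 0 <= b 0 i)].

(** A folding time, a direction and an endpoint, the last two as coordinates relative to lambda. *)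
Definition state : Type := (R * 'rV[int]_n * 'rV[int]_n)%type.

(** The latest fold comes first. A path starts linearly, so its first direction and endpoint agree
    and have the norm of lambda. At time t a fold moves the endpoint by 1 - t times the change of
    direction, which is the equation for m. *)
Inductive chain : seq state -> Prop :=
| chain_start c : energy c = 0 -> chain [:: (0, c, c)]
| chain_fold t t' u c s b m :
    chain ((t', u, c + m *: b) :: s) -> fold_ok c b m ->
    m%:~R = (1 - t) * (height_at u b)%:~R ->
    chain ((t, u - height_at u b *: b, c) :: (t', u, c + m *: b) :: s).

Lemma energy_fold c b m : fold_ok c b m -> energy c <= energy (c + m *: b).
Proof.
by case=> hb m0 h; rewrite energyD // lerDl; case: h => [h|[-> _]]; nia.
Qed.

(** The energy is 0 at the start and never increases along folds. *)
Lemma chain_energy s x : chain (x :: s) -> energy x.2 <= 0.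
Proof.
move sE : (x :: s) => s' hs; elim: hs x s sE => [c h x s [-> _]|] /=.
  by rewrite h.
move=> t t' u c s0 b m _ IH hf _ x s [-> _].
exact: le_trans (energy_fold hf) (IH _ _ erefl).
Qed.

(** The two bounds supplied by positivity of the level; the lemmas of the same names prove them for
    affine matrices. *)
Hypothesis bounded_roots : forall c (K : int), exists M : int, forall b,
  gram b b = 2 -> `|height_at c b| <= K -> forall i, `|b 0 i| <= M.
Hypothesis bounded_above : forall c, exists M : int, forall c',
  (forall i, c 0 i <= c' 0 i) -> energy c' <= 0 -> forall i, `|c' 0 i| <= M.

Lemma finite_folds c : finite_set
  [set x : int * 'rV[int]_n | fold_ok c x.2 x.1 /\ energy (c + x.1 *: x.2) <= 0].
Proof.
have [M1 hM1] := bounded_roots c `|energy c|.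
have [M2 hM2] := bounded_above c.
have [M3 hM3] : exists M3 : int, forall i, `|c 0 i| <= M3.
  exists (\sum_i `|c 0 i|) => i; rewrite (bigD1 i) //= lerDl.
  exact: sumr_ge0.
pose K : int := `|energy c| + `|M1| + `|M2| + `|M3|.
apply: (@sub_finite_set _ _
  ([set m : int | `|m| <= K] `*` [set b : 'rV[int]_n | forall i, `|b 0 i| <= K])).
  2: by apply: finite_setX; [exact: finite_int_box|exact: finite_box].
case=> m b /= [[hb m0 hN]]; have := energyD c m hb; set N : int := height_at c b + m in hN *.
(* If N > 0, then 2 m N <= - [energy c] bounds m and N, hence the height N - m of b at c, and
   [bounded_roots] applies. *)
move=> -> hE; case: hN => [N0|[N0 b0]].
  have h1 : `|height_at c b| <= `|energy c|.
    have : N <= m * N by nia.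
    have : m <= m * N by nia.
    rewrite /N in hE N0 *; lia.
  split=> [|i] /=; last by have := hM1 b hb h1 i; rewrite /K; lia.
  have : m <= m * N by nia.
  rewrite /K; lia.
(* If N = 0, the energy is unchanged and c + m b lies above c, so [bounded_above] bounds m b. *)
rewrite N0 mulr0 addr0 in hE.
have hc i : c 0 i <= (c + m *: b) 0 i.
  by rewrite !mxE lerDl mulr_ge0 // ltW.
have hE' : energy (c + m *: b) <= 0 by rewrite energyD // -/N N0 mulr0 addr0.
have hmb i : m * b 0 i <= `|M2| + `|M3|.
  have := hM2 _ hc hE' i; have := hM3 i; rewrite !mxE.
  by move: (c 0 i) (b 0 i) => x y; lia.
(* A vector of norm 2 is non-zero; a positive coordinate of b lets the bound on m b bound m. *)
have [i bi] : exists i, 0 < b 0 i.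
  apply/not_existsP => hbi.
  have b00 : b = 0.
    by apply/rowP => i; rewrite mxE; have := hbi i; have := b0 i; lia.
  by move: hb; rewrite b00 /gram /pairing mul0mx mxE.
split=> [|j] /=.
  by have := hmb i; rewrite /K; nia.
by have := hmb j; have := b0 j; rewrite /K; nia.
Qed.

(* The folding time is forced by [m = (1 - t) a]. *)
Definition extend (x : int * 'rV[int]_n) (s : seq state) : seq state :=
  let y := head (0, 0, 0) s in
  let a := height_at y.1.2 x.2 in
  (1 - x.1%:~R / a%:~R, y.1.2 - a *: x.2, y.2 - x.1 *: x.2) :: s.

Definition chains_to c : set (seq state) :=
  [set s | chain s /\ (head (0, 0, 0) s).2 = c].

Lemma chains_to_sub c : chains_to c `<=`
  [set [:: (0, c, c)]] `|`
  \bigcup_(x in [set x | fold_ok c x.2 x.1 /\ energy (c + x.1 *: x.2) <= 0])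
    (extend x @` chains_to (c + x.1 *: x.2)).
Proof.
move=> s [hs]; case: hs => [c' _ /= ->|t t' u c' s' b m hs hf ht /= cE]; first by left.
right; rewrite -cE; exists (m, b) => /=.
  by split => //; exact: (chain_energy hs).
exists ((t', u, c' + m *: b) :: s'); first by split.
rewrite /extend /= addrK; congr ((_, _, _) :: _).
case: hf => _ m0 _.
(* As m = (1 - t) a is positive, a is non-zero and the division in [extend] gives back t. *)
have /lt0r_neq0 : 0 < (m%:~R : R) by rewrite ltr0z.
rewrite ht mulf_eq0 negb_or => /andP[_ a0]; field.
exact: a0.
Qed.

(* Lexicographic induction on [- energy] and then on the distance of the
   coordinate sum to its maximum over [bounded_above]. *)
Theorem finite_chains_to c : finite_set (chains_to c).
Proof.
have [k] := ubnP (absz (Num.max 0 (- energy c))); elim: k c => // k IHk c hk.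
have [M hM] := bounded_above c.
pose ht (d : 'rV[int]_n) : int := \sum_i d 0 i.
have htb (d : 'rV[int]_n) : (forall i, c 0 i <= d 0 i) -> energy d <= 0 -> ht d <= n%:Z * M.
  move=> h1 h2; rewrite /ht; apply: (@le_trans _ _ (\sum_(i < n) M)).
    by apply: ler_sum => i _; apply: le_trans (ler_norm _) _; exact: hM.
  by rewrite sumr_const card_ord -mulr_natl natz.
(* The inner induction ranges over all d above c with the energy of c, so that the single bound [M]
   obtained for c serves throughout. *)
suff H j (d : 'rV[int]_n) : (forall i, c 0 i <= d 0 i) -> energy d = energy c ->
    (absz (Num.max 0%R (n%:Z * M - ht d)%R) < j)%N -> finite_set (chains_to d).
  by apply: (H _ c _ _ (ltnSn _)).
elim: j d => // j IHj d cd ed hj.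
apply: sub_finite_set (@chains_to_sub d) _.
rewrite finite_setU; split; first exact: finite_set1.
apply: bigcup_finite; first exact: finite_folds.
move=> [m b] /= [hf hE]; apply: finite_image.
have [hb m0 [N0|[N0 b0]]] := hf.
  apply: IHk; have := energyD d m hb; rewrite ed.
  move: hE hk; set e' := energy _; set e := energy _; set N := _ + m in N0 *.
  by move=> hE hk h; nia.
have hE' := energyD d m hb; rewrite N0 mulr0 addr0 in hE'.
have hd i : d 0 i <= (d + m *: b) 0 i by rewrite !mxE lerDl mulr_ge0 // ltW.
have cd' i : c 0 i <= (d + m *: b) 0 i by exact: le_trans (cd i) (hd i).
apply: IHj => //; first by rewrite hE'.
have := htb _ cd' hE.
have : ht d < ht (d + m *: b).
  have [i bi] : exists i, 0 < b 0 i.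
    apply/not_existsP => hbi.
    have b00 : b = 0.
      by apply/rowP => i; rewrite mxE; have := hbi i; have := b0 i; lia.
    by move: hb; rewrite b00 /gram /pairing mul0mx mxE.
  rewrite /ht (bigD1 i) //= [ltRHS](bigD1 i) //= ltr_leD //.
    by rewrite !mxE ltrDl mulr_gt0.
  by apply: ler_sum => k' _; exact: hd.
move: hj; lia.
Qed.

End Chains.

(** * Semidefiniteness of an affine Cartan matrix and bounds from a positive level *)

Section NullVector.
Variables (n : nat) (A : 'M[int]_n) (delta : 'rV[int]_n).
Hypothesis A_sym : A^T = A.
Hypothesis A_offdiag : forall i j, i != j -> A i j <= 0.
Hypothesis delta_gt0 : forall i, 0 < delta 0 i.
Hypothesis A_delta : A *m delta^T = 0.
Implicit Types x : 'rV[int]_n.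

Notation gram := (gram A).

(** In these coordinates the multiples of delta are the constant vectors. *)
Definition ratio x i : rat := (x 0 i)%:~R / (delta 0 i)%:~R.

Lemma ratioK x i : (x 0 i)%:~R = (delta 0 i)%:~R * ratio x i.
Proof.
rewrite /ratio mulrC divfK // intr_eq0; exact: lt0r_neq0.
Qed.

Lemma norm_delta i : `|(delta 0 i)%:~R| = (delta 0 i)%:~R :> rat.
Proof. by rewrite ger0_norm // ler0z ltW. Qed.

Lemma sum_A_delta i : \sum_j (A i j)%:~R * (delta 0 j)%:~R = 0 :> rat.
Proof.
have /matrixP/(_ i 0) := A_delta; rewrite !mxE => h.
rewrite -[RHS](rmorph0 intr) -h rmorph_sum; apply: eq_bigr => j _.
by rewrite mxE rmorphM.
Qed.

Lemma gramE x : gram x x = \sum_i \sum_j A i j * x 0 i * x 0 j.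
Proof.
rewrite /gram pairingE; apply: eq_bigr => i _; rewrite mxE mulr_sumr.
by apply: eq_bigr => j _; rewrite mxE mulrCA mulrA.
Qed.

(** After expansion of (y_i - y_j)^2, the pure squares y_i^2 and y_j^2 cancel by A delta = 0 and
    symmetry; the cross terms give the form. *)
Lemma gram_sum_squares x : 2 * (gram x x)%:~R =
  \sum_i \sum_j (- (A i j)%:~R) * (delta 0 i)%:~R * (delta 0 j)%:~R *
    (ratio x i - ratio x j) ^+ 2.
Proof.
pose a i j : rat := (A i j)%:~R; pose d i : rat := (delta 0 i)%:~R.
pose y := ratio x.
have -> : \sum_i \sum_j (- (A i j)%:~R) * (delta 0 i)%:~R * (delta 0 j)%:~R *
    (ratio x i - ratio x j) ^+ 2 =
  2 * (\sum_i \sum_j a i j * (d i * y i) * (d j * y j))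
  - \sum_i \sum_j a i j * d i * d j * y i ^+ 2
  - \sum_i \sum_j a i j * d i * d j * y j ^+ 2.
  rewrite mulr_sumr -!sumrB; apply: eq_bigr => i _.
  rewrite mulr_sumr -!sumrB; apply: eq_bigr => j _.
  by rewrite -/(a i j) -/(d i) -/(d j) -/y; ring.
have h1 : \sum_i \sum_j a i j * d i * d j * y i ^+ 2 = 0.
  apply: big1 => i _.
  transitivity (d i * y i ^+ 2 * \sum_j a i j * d j).
    by rewrite mulr_sumr; apply: eq_bigr => j _; ring.
  by rewrite sum_A_delta mulr0.
have h2 : \sum_i \sum_j a i j * d i * d j * y j ^+ 2 = 0.
  rewrite exchange_big -[RHS]h1 /=; apply: eq_bigr => i _; apply: eq_bigr => j _.
  have -> : a j i = a i j by rewrite /a -[in LHS]A_sym mxE.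
  by ring.
rewrite h1 h2 !subr0 gramE rmorph_sum; congr (_ * _).
apply: eq_bigr => i _; rewrite rmorph_sum; apply: eq_bigr => j _.
by rewrite !rmorphM /= (ratioK x i) (ratioK x j).
Qed.

Lemma square_term_ge0 x i j :
  0 <= (- (A i j)%:~R) * (delta 0 i)%:~R * (delta 0 j)%:~R *
    (ratio x i - ratio x j) ^+ 2.
Proof.
have [->|ij] := eqVneq i j; first by rewrite subrr expr0n mulr0.
apply: mulr_ge0; last exact: sqr_ge0.
apply: mulr_ge0; last by rewrite ler0z ltW.
apply: mulr_ge0; last by rewrite ler0z ltW.
by rewrite oppr_ge0 lerz0 A_offdiag.
Qed.

Lemma gram_ge0 x : 0 <= (gram x x)%:~R :> rat.
Proof.
rewrite -(pmulr_rge0 _ (ltr0Sn _ 1)) gram_sum_squares.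
by do 2![apply: sumr_ge0 => ? _]; exact: square_term_ge0.
Qed.

Definition linked i j := exists2 B : rat, 0 <= B &
  forall x, (ratio x i - ratio x j) ^+ 2 <= B * (gram x x)%:~R.

(** The (i, j) square alone is at most the whole sum, which is twice the form, and its coefficient
    is an integer at least 1. *)
Lemma linked_edge i j : A i j < 0 -> linked i j.
Proof.
move=> Aij; exists 2 => // x.
rewrite gram_sum_squares (bigD1 i) //= (bigD1 j) //= -addrA.
apply: ler_wpDr.
  apply: addr_ge0; first by apply: sumr_ge0 => ? _; exact: square_term_ge0.
  by do 2![apply: sumr_ge0 => ? _]; exact: square_term_ge0.
apply: ler_peMl; first exact: sqr_ge0.
rewrite -rmorphN /= -!rmorphM /= ler1z.
have := delta_gt0 i; have := delta_gt0 j.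
move: (A i j) (delta 0 i) (delta 0 j) Aij => a d e *; nia.
Qed.

Lemma linked_sym i j : linked i j -> linked j i.
Proof. by case=> B B0 h; exists B => // x; rewrite -sqrrN opprB. Qed.

Lemma linked_trans j i k : linked i j -> linked j k -> linked i k.
Proof.
case=> B B0 hB [B' B'0 hB']; exists (2 * B + 2 * B'); first by lra.
(* With p, q, s the three ratios, (p - s)^2 <= 2 (p - q)^2 + 2 (q - s)^2, and the defect is (p - 2 q
   + s)^2. *)
move=> x; have := hB x; have := hB' x; have := sqr_ge0 (ratio x i - 2 * ratio x j + ratio x k).
have := gram_ge0 x.
move: (ratio x i) (ratio x j) (ratio x k) (_%:~R) => p q s t; nra.
Qed.

Variables (o : 'I_n) (eta : 'cV[int]_n).
Hypothesis linkedP : forall i, linked i o.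
Hypothesis level_gt0 : 0 < pairing delta eta.

Let W : rat := \sum_i (delta 0 i)%:~R * `|(eta i 0)%:~R|.

(** From D^2 <= Q follows D <= Q / s + s, as either D <= s or D s <= D^2. This replaces a square
    root, and a large s makes the coefficient of the form small. *)
Lemma ratio_bound : exists2 B : rat, 0 <= B &
  forall x i s, 0 < s -> `|ratio x i - ratio x o| <= B * (gram x x)%:~R / s + s.
Proof.
have [B hB] := choice (fun i => let: ex_intro2 B h h' := linkedP i in
  ex_intro (fun B => 0 <= B /\ forall x, _ <= B * _) B (conj h h')).
have B0 : 0 <= \sum_i B i by apply: sumr_ge0 => i _; case: (hB i).
exists (\sum_i B i) => // x i s s0.
have : (ratio x i - ratio x o) ^+ 2 <= (\sum_i B i) * (gram x x)%:~R.
  apply: le_trans (proj2 (hB i) x) _; apply: ler_wpM2r; first exact: gram_ge0.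
  by rewrite (bigD1 i) //= lerDl; apply: sumr_ge0 => j _; case: (hB j).
rewrite -real_normK ?num_real //.
have := normr_ge0 (ratio x i - ratio x o); set D := `|_|; set Q := _ * _ => D0 hQ.
rewrite -(ler_pM2r s0) mulrDl divfK ?lt0r_neq0 //.
nra.
Qed.

(** Split x as [ratio x o] times delta plus a remainder: the first part contributes a multiple of
    the level, the second the error E. *)
Lemma pairing_ratio x : exists2 E : rat,
  (pairing x eta)%:~R = ratio x o * (pairing delta eta)%:~R + E &
  forall X, (forall i, `|ratio x i - ratio x o| <= X) -> `|E| <= W * X.
Proof.
exists (\sum_i (delta 0 i)%:~R * (eta i 0)%:~R * (ratio x i - ratio x o)).
  rewrite !pairingE !rmorph_sum mulr_sumr -big_split /=; apply: eq_bigr => i _.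
  rewrite !rmorphM /= (ratioK x i); ring.
move=> X hX; apply: le_trans (ler_norm_sum _ _ _) _.
rewrite mulr_suml; apply: ler_sum => i _; rewrite !normrM norm_delta.
by apply: ler_wpM2l => //; rewrite mulr_ge0 // ler0z ltW.
Qed.

Lemma W_ge0 : 0 <= W.
Proof. by apply: sumr_ge0 => i _; rewrite mulr_ge0 // ler0z ltW. Qed.

Lemma box_of_ratio (P : 'rV[int]_n -> Prop) (X : rat) :
  (forall x, P x -> `|ratio x o| <= X /\ forall i, `|ratio x i - ratio x o| <= X) ->
  exists M : int, forall x, P x -> forall i, `|x 0 i| <= M.
Proof.
move=> hP; pose Z : rat := (\sum_i (delta 0 i)%:~R) * (2 * X).
exists (Num.bound Z)%:Z => x /hP[h0 h] i.
have X0 : 0 <= X by apply: le_trans h0.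
have s0 : 0 <= \sum_i (delta 0 i)%:~R :> rat.
  by apply: sumr_ge0 => j _; rewrite ler0z ltW.
have Z0 : 0 <= Z by rewrite !mulr_ge0.
suff : (`|x 0 i|%:~R : rat) <= Z.
  move=> hZ; have := le_lt_trans hZ (archi_boundP Z0).
  by rewrite -[(Num.bound Z)%:R]/((Num.bound Z)%:Z%:~R) ltr_int => /ltW.
rewrite intr_norm (ratioK x i) normrM norm_delta.
apply: (@le_trans _ _ ((delta 0 i)%:~R * (2 * X))).
  apply: ler_wpM2l; first by rewrite ler0z ltW.
  rewrite -[ratio x i](subrK (ratio x o)) (le_trans (ler_normD _ _)) //.
  have := h i; lra.
apply: ler_wpM2r; first by lra.
by rewrite (bigD1 i) //= lerDl; apply: sumr_ge0 => j _; rewrite ler0z ltW.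
Qed.

(** Norm 2 bounds the deviation of x from a multiple of delta; that multiple is bounded too, since
    the level is at least 1 and the pairing at most K. *)
Lemma bounded_gram_pairing (K : int) : exists M : int, forall x,
  gram x x = 2 -> `|pairing x eta| <= K -> forall i, `|x 0 i| <= M.
Proof.
have [B B0 hB] := ratio_bound; pose Y : rat := B * 2 + 1.
suff [M hM] : exists M : int, forall x, gram x x = 2 /\ `|pairing x eta| <= K ->
    forall i, `|x 0 i| <= M by exists M => x h h'; exact: hM.
apply: (@box_of_ratio _ (K%:~R + W * Y + Y)) => x [hx hK].
have hY i : `|ratio x i - ratio x o| <= Y.
  by have := hB x i 1 ltr01; rewrite hx divr1.
have [E hE /(_ _ hY) E0] := pairing_ratio x.
have W0 := W_ge0.
have Y0 : 0 <= Y by rewrite /Y; lra.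
have WY0 : 0 <= W * Y by exact: mulr_ge0.
have K0 : 0 <= K%:~R :> rat by rewrite ler0z (le_trans _ hK).
split=> [|i]; last by apply: le_trans (hY i) _; lra.
move: hK; rewrite -(ler_int rat) intr_norm hE => hK.
have : `|ratio x o * (pairing delta eta)%:~R| <= K%:~R + W * Y.
  rewrite -[_ * _](addrK E) (le_trans (ler_normB _ _)) //; lra.
have h0 : 0 <= (pairing delta eta)%:~R :> rat by rewrite ler0z ltW.
rewrite normrM (ger0_norm h0) => h.
have : 1 <= (pairing delta eta)%:~R :> rat by rewrite ler1z.
have := normr_ge0 (ratio x o).
move: h; move: (`|ratio x o|) ((pairing delta eta)%:~R) => p q; nra.
Qed.

(** With y = [ratio x o], h the level and q the form, the energy is 2 y h + 2 E + q. The lower bound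
    on y limits q, and then positivity of h limits y from above. *)
Lemma bounded_energy_above (c : int) : exists M : int, forall x,
  c <= x 0 o -> energy A eta x <= 0 -> forall i, `|x 0 i| <= M.
Proof.
have [B B0 hB] := ratio_bound; have W0 := W_ge0.
have WB0 : 0 <= W * B by exact: mulr_ge0.
(* This s makes the error 2 |E| absorb at most half of q. *)
have [s s0 sWB] : exists2 s, 0 < s & 4 * (W * B) <= s.
  by exists (4 * (W * B) + 1); lra.
have [L L0 cL] : exists2 L : rat, 0 <= L & - L <= c%:~R.
  exists `|c%:~R|; first exact: normr_ge0.
  by rewrite lerNl -normrN ler_norm.
have h1 : 1 <= (pairing delta eta)%:~R :> rat by rewrite ler1z.
have hE x : exists2 E : rat,
    (pairing x eta)%:~R = ratio x o * (pairing delta eta)%:~R + E &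
    - (2 * E) <= (gram x x)%:~R / 2 + 2 * (W * s).
  have [E hE /(_ _ (fun i => hB x i s s0)) E0] := pairing_ratio x.
  exists E => //; have q0 := gram_ge0 x.
  have hs : W * (B * (gram x x)%:~R / s) <= (gram x x)%:~R / 4.
    have -> : W * (B * (gram x x)%:~R / s) = W * B * (gram x x)%:~R / s by ring.
    rewrite ler_pdivrMr //; nra.
  have := ler_norm (- E); rewrite normrN mulrDr in E0 *; lra.
clear sWB; move: (_%:~R) h1 hE => h h1 hE.
have Ws0 : 0 <= W * s by rewrite mulr_ge0 // ltW.
have Lh0 : 0 <= L * h by rewrite mulr_ge0 //; lra.
(* Q bounds q: it comes from 2 y h + q / 2 <= 2 W s and y >= - L. *)
have [Q QE] : exists Q, Q = 4 * (W * s) + 4 * (L * h) by eexists.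
have [Y YE] : exists Y, Y = B * Q / s + s by eexists.
have Y0 : 0 <= Y.
  rewrite YE addr_ge0 ?(ltW s0) // divr_ge0 ?(ltW s0) // mulr_ge0 // QE.
  lra.
suff [M hM] : exists M : int, forall x, c <= x 0 o /\ energy A eta x <= 0 ->
    forall i, `|x 0 i| <= M by exists M => x h' h''; exact: hM.
apply: (@box_of_ratio _ (L + W * s + Y)) => x [hc he].
have [E hE1 hE2] := hE x; have hBx := hB x; have q0 := gram_ge0 x.
move: he; rewrite -(ler_int rat) /energy rmorphD rmorphM /= hE1 => he.
have yL : - L <= ratio x o.
  have d1 : 1 <= (delta 0 o)%:~R :> rat by rewrite ler1z; exact: delta_gt0.
  have d0 : 0 < (delta 0 o)%:~R :> rat by rewrite ltr0z; exact: delta_gt0.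
  have hc' : c%:~R <= (x 0 o)%:~R :> rat by rewrite ler_int.
  rewrite /ratio ler_pdivlMr //; apply: le_trans hc'; apply: le_trans cL.
  by rewrite mulNr lerN2 ler_peMr.
have hq : (gram x x)%:~R <= Q.
  rewrite QE; 
  have : - L * h <= ratio x o * h by rewrite ler_wpM2r //; lra.
  rewrite mulNr; lra.
split; last first.
  move=> i; apply: (@le_trans _ _ Y); last by lra.
  apply: le_trans (hBx i s s0) _; rewrite YE lerD2r ler_wpM2r ?invr_ge0 ?(ltW s0) //.
  exact: ler_wpM2l.
have yu : ratio x o * h <= W * s by lra.
rewrite ler_norml; apply/andP; split; first by lra.
have : ratio x o <= W * s.
  have [y0|y0] := lerP (ratio x o) 0; first exact: le_trans Ws0.
  by apply: le_trans yu; rewrite ler_pMr.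
lra.
Qed.

End NullVector.

(** * Finite simply laced diagrams *)

Section SimplyLaced.
Variables l b : nat.
Notation C := (simply_laced_cartan l b).

Lemma simply_laced_sym : C^T = C.
Proof.
apply/matrixP => i j; rewrite !mxE eq_sym orbC.
by case: eqP => // ->.
Qed.

Lemma simply_laced_diag i : C i i = 2.
Proof. by rewrite mxE eqxx. Qed.

Lemma simply_laced_offdiag i j : i != j -> C i j <= 0.
Proof. by rewrite mxE => /negPf ->; case: ifP. Qed.

(** The neighbour is the predecessor in the chain, or b for the last node. Descending to node 0 then
    shows that the diagram is connected. *)
Lemma simply_laced_edge (i : 'I_l) : (b.+1 < l)%N || (l == 1)%N -> (0 < i)%N ->
  exists2 j : 'I_l, (j < i)%N & C i j < 0.
Proof.
move=> hb i0; have il := ltn_ord i.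
have [j ji je] : exists2 j : nat, (j < i)%N & dynkin_edge l b j i.
  rewrite /dynkin_edge; case: (eqVneq i.+1 l) => h; last first.
    by exists i.-1; rewrite prednK ?leqnn ?eqxx.
  by exists b; rewrite ?eqxx ?andbT //; lia.
exists (Ordinal (ltn_trans ji il)) => //.
rewrite mxE -val_eqE /= [_ || _]orbC je /=.
by case: eqP => // h; lia.
Qed.

End SimplyLaced.

(** The alternative [l == 1] is type A_1, where truncated subtraction gives b = 0, the only node. *)
Lemma type_ADE_simply_laced l (C : 'M[int]_l) : type_ADE C ->
  exists2 b, C = simply_laced_cartan l b & (b.+1 < l)%N || (l == 1)%N.
Proof.
by case=> [[l1 ->]|[l4 ->]|[/[!inE] hl ->]]; eexists => //; lia.
Qed.

(** * Untwisted affine Cartan matrices *)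

Section Affinization.
Variables (l : nat) (C : 'M[int]_l) (theta : 'rV[int]_l).
Hypotheses (hC : type_ADE C) (htheta : highest_root C theta).

Lemma cartan_sym : C^T = C.
Proof. by have [b -> _] := type_ADE_simply_laced hC; exact: simply_laced_sym. Qed.

Lemma cartan_diag i : C i i = 2.
Proof. by have [b -> _] := type_ADE_simply_laced hC; exact: simply_laced_diag. Qed.

Lemma cartan_offdiag i j : i != j -> C i j <= 0.
Proof. by have [b -> _] := type_ADE_simply_laced hC; exact: simply_laced_offdiag. Qed.

Lemma cartan_edge (i : 'I_l) : (0 < i)%N -> exists2 j : 'I_l, (j < i)%N & C i j < 0.
Proof. by have [b -> hb] := type_ADE_simply_laced hC; exact: simply_laced_edge. Qed.

Lemma gram_delta x i : gram C (delta_mx 0 i) x = (C *m x^T) i 0.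
Proof.
rewrite /gram pairingE (bigD1 i) //= mxE !eqxx mul1r big1 ?addr0 // => j ji.
by rewrite mxE (negPf ji) andbF mul0r.
Qed.

Lemma gram_delta_delta i : gram C (delta_mx 0 i) (delta_mx 0 i) = 2.
Proof.
by rewrite gram_delta trmx_delta -colE mxE cartan_diag.
Qed.

Lemma finite_root_norm b : finite_root C b -> gram C b b = 2.
Proof.
elim=> [i|{}b i _ IH]; first exact: gram_delta_delta.
rewrite -gram_delta gramBl !gramBr !gramZl !gramZr gram_delta_delta IH.
by rewrite (gramC cartan_sym b); ring.
Qed.

Lemma theta_gt0 i : 0 < theta 0 i.
Proof.
have [_ /(_ _ (finite_root_simple C i) i)] := htheta.
by rewrite mxE !eqxx; apply: lt_le_trans.
Qed.

(** Otherwise the i-th simple reflection would send theta to a root with a larger i-th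
    coordinate. *)
Lemma theta_dominant i : 0 <= (C *m theta^T) i 0.
Proof.
have [h /(_ _ (finite_root_refl i h) i)] := htheta.
by rewrite mxE [X in _ + X]mxE [X in - X]mxE [delta_mx _ _ _ _]mxE !eqxx mulr1 gerBl.
Qed.

(** The coordinates of [imaginary_root] over the affine simple roots. *)
Definition null_root : 'rV[int]_(1 + l) := row_mx 1%:M theta.

Notation A := (affinization C theta).

Lemma affinization_sym : A^T = A.
Proof.
rewrite /affinization tr_block_mx tr_scalar_mx cartan_sym !linearN /=.
by rewrite !trmx_mul trmxK cartan_sym.
Qed.

Lemma theta_theta : theta *m C *m theta^T = 2%:M.
Proof.
rewrite -mulmxA pairing_mulmx; congr (_%:M).
by case: htheta => h _; exact: finite_root_norm.
Qed.

Lemma affinization_null : A *m null_root^T = 0.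
Proof.
rewrite /affinization /null_root tr_row_mx mul_block_col trmx1 !mulmx1.
by rewrite mulNmx theta_theta subrr addrC subrr col_mx0.
Qed.

Lemma affinization_diag i : A i i = 2.
Proof.
case: (splitP i) => j jE.
  have -> : i = lshift l j by exact/val_inj.
  by rewrite block_mxEul mxE eqxx.
have -> : i = rshift 1 j by exact/val_inj.
by rewrite block_mxEdr cartan_diag.
Qed.

Lemma affinization_row0 i j : A (lshift l i) (rshift 1 j) = - (C *m theta^T) j 0.
Proof.
rewrite -[in LHS]affinization_sym mxE block_mxEdl mxE.
by rewrite [i]ord1.
Qed.

Lemma affinization_offdiag i j : i != j -> A i j <= 0.
Proof.
have E (k : 'I_(1 + l)) : k = lshift l 0 \/ exists k', k = rshift 1 k'.
  case: (splitP k) => k' kE; [left|right; exists k']; apply/val_inj => //=.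
  by rewrite kE ord1.
case: (E i) => [->|[i' ->]]; case: (E j) => [->|[j' ->]]; rewrite ?eqxx // => ij.
- by rewrite affinization_row0 oppr_le0 theta_dominant.
- by rewrite -affinization_sym mxE affinization_row0 oppr_le0 theta_dominant.
- by rewrite block_mxEdr cartan_offdiag // (contraNneq _ ij) // => ->.
Qed.

Lemma null_root_gt0 i : 0 < null_root 0 i.
Proof.
rewrite mxE; case: splitP => j _; last exact: theta_gt0.
by rewrite [j]ord1 mxE.
Qed.

(** The affine diagram is connected: every finite node descends to the first one, which is joined to
    the affine node through a neighbour k of the latter. *)
Lemma linked_affine i : linked A null_root i (lshift l 0).
Proof.
have link_edge i1 i2 : A i1 i2 < 0 -> linked A null_root i1 i2.
  exact: (linked_edge affinization_sym affinization_offdiag null_root_gt0 affinization_null).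
have link_trans i2 i1 i3 : linked A null_root i1 i2 -> linked A null_root i2 i3 ->
    linked A null_root i1 i3.
  exact: (linked_trans affinization_sym affinization_offdiag null_root_gt0 affinization_null).
(* If theta were orthogonal to all simple roots, its norm would be 0 instead of 2. *)
have [k hk] : exists k, 0 < (C *m theta^T) k 0.
  apply/not_existsP => h.
  have : C *m theta^T = 0.
    apply/colP => k; rewrite [RHS]mxE; apply/eqP; rewrite eq_le theta_dominant andbT.
    by rewrite leNgt; apply/negP.
  have := theta_theta; rewrite -mulmxA => + h0; rewrite h0 mulmx0.
  by move=> /matrixP/(_ 0 0); rewrite !mxE.
have l0 : (0 < l)%N by case: k hk => m hm _; exact: leq_ltn_trans hm.
have h0 m (j : 'I_l) : (j < m)%N -> linked A null_root (rshift 1 j) (rshift 1 (Ordinal l0)).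
  elim: m j => // m IH j jm; case: (posnP j) => j0.
    have -> : j = Ordinal l0 by exact/val_inj.
    exists 0 => // x; rewrite subrr expr0n mul0r //.
  have [j' j'j hj'] := cartan_edge j0.
  apply: (link_trans (rshift 1 j')); first by apply: link_edge; rewrite block_mxEdr.
  by apply: IH; lia.
have hk0 : linked A null_root (rshift 1 (Ordinal l0)) (lshift l 0).
  apply: (link_trans (rshift 1 k)); first by apply: linked_sym; apply: (h0 k.+1).
  by apply: linked_sym; apply: link_edge; rewrite affinization_row0 oppr_lt0.
case: (splitP i) => j jE.
  have -> : i = lshift l 0 by apply/val_inj; rewrite /= jE ord1.
  by exists 0 => // x; rewrite subrr expr0n mul0r.
have -> : i = rshift 1 j by exact/val_inj.
by apply: link_trans hk0; exact: (h0 j.+1).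
Qed.

Variable (eta : 'cV[int]_(1 + l)).
Hypothesis level_gt0 : 0 < pairing null_root eta.

(** Heights at c are pairings with eta + A c^T, whose level is that of eta because delta is in the
    kernel of A. *)
Lemma bounded_roots c (K : int) : exists M : int, forall b,
  gram A b b = 2 -> `|height_at A eta c b| <= K -> forall i, `|b 0 i| <= M.
Proof.
have hl : 0 < pairing null_root (eta + A *m c^T).
  rewrite pairingDr -[pairing _ (A *m _)]/(gram A null_root c) (gramC affinization_sym).
  by rewrite /gram affinization_null [pairing c 0]/pairing mulmx0 mxE addr0.
have [M hM] := bounded_gram_pairing affinization_sym affinization_offdiag null_root_gt0
  affinization_null linked_affine hl K.
exists M => b hb h; apply: hM => //.
by rewrite pairingDr.
Qed.

Lemma bounded_above (c : 'rV[int]_(1 + l)) : exists M : int, forall c' : 'rV[int]_(1 + l),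
  (forall i, c 0 i <= c' 0 i) -> energy A eta c' <= 0 -> forall i, `|c' 0 i| <= M.
Proof.
have [M hM] := bounded_energy_above affinization_sym affinization_offdiag null_root_gt0
  affinization_null linked_affine level_gt0 (c 0 (lshift l 0)).
by exists M => c' hc he; exact: hM.
Qed.

End Affinization.

(** * The affine Weyl group acting on coweights and affine roots *)

Lemma invmx_uniq (K : comUnitRingType) (r : nat) (M N : 'M[K]_r) :
  M *m N = 1%:M -> invmx M = N.
Proof.
by move=> h; have [hM _] := mulmx1_unit h; rewrite -[LHS]mulmx1 -h mulKmx.
Qed.

Lemma invmx_mulmx (K : comUnitRingType) (r : nat) (M N : 'M[K]_r) :
  M \in unitmx -> N \in unitmx -> invmx (M *m N) = invmx N *m invmx M.
Proof.
by move=> hM hN; apply: invmx_uniq; rewrite mulmxA mulmxK // mulmxV.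
Qed.

Section AffineGroup.
Variable r : nat.
Implicit Types (x y z : aff r) (v : 'cV[int]_r) (g : affroot r).

Definition iact x v : 'cV[int]_r := x.1 *m (v + x.2).

Lemma iact_amul x y v : y.1 \in unitmx -> iact (amul x y) v = iact x (iact y v).
Proof.
move=> hy; rewrite /iact /= -mulmxA; congr (_ *m _).
by rewrite addrCA mulmxDr mulKVmx // [LHS]addrC.
Qed.

Lemma amulA x y z : y.1 \in unitmx -> z.1 \in unitmx ->
  amul (amul x y) z = amul x (amul y z).
Proof.
move=> hy hz; rewrite /amul /= mulmxA invmx_mulmx //.
by rewrite mulmxDr mulmxA addrA.
Qed.

Lemma amul1x x : amul (aone r) x = x.
Proof. by case: x => a b; rewrite /amul /= mul1mx mulmx0 add0r. Qed.

Lemma amulVx x : x.1 \in unitmx -> amul (ainv x) x = aone r.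
Proof.
by move=> hx; rewrite /amul /= mulVmx // mulmxN mulKmx // addNr.
Qed.

Lemma amulxV x : x.1 \in unitmx -> amul x (ainv x) = aone r.
Proof. by move=> hx; rewrite /amul /= mulmxV // invmxK addrN. Qed.

Lemma ract_amul x y g : x.1 \in unitmx -> y.1 \in unitmx ->
  ract (amul x y) g = ract x (ract y g).
Proof.
move=> hx hy; rewrite /ract /= invmx_mulmx // mulmxA; congr (_, _).
by rewrite pairingDr -pairing_mul; ring.
Qed.

Lemma ractN x g : ract x (- g.1, - g.2) = (- (ract x g).1, - (ract x g).2).
Proof. by rewrite /ract /= mulNmx pairingNl opprD. Qed.

Lemma aact_to_real (R : realType) x v :
  aact x (to_real R v) = to_real R (iact x v).
Proof. by rewrite /aact /to_real /iact mulmxDr map_mxD !map_mxM. Qed.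

Lemma to_real_inj (R : realType) : injective (@to_real R r).
Proof.
move=> v w /matrixP h; apply/matrixP => i j; have := h i j.
by rewrite !mxE => /intr_inj.
Qed.

Lemma pairing_to_real (R : realType) (b : 'rV[int]_r) v :
  pairing (map_mx intr b) (to_real R v) = (pairing b v)%:~R.
Proof. by rewrite /pairing -map_mxM mxE. Qed.

End AffineGroup.

(** * Real roots, coroots and the Weyl group in simple coordinates *)

Section RootDatum.
Variables (n : nat) (A : 'M[int]_n) (r : nat) (D : root_datum A r).
Hypotheses (A_sym : A^T = A) (A_diag : forall i, A i i = 2).
Notation gram := (gram A).

Definition root_mx : 'M[int]_(n, r) := \matrix_i sroot D i.
Definition coroot_mx : 'M[int]_(r, n) := \matrix_(i, j) scoroot D j i 0.

Definition root_comb (c : 'rV[int]_n) : 'rV[int]_r := c *m root_mx.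
Definition coroot_comb (c : 'rV[int]_n) : 'cV[int]_r := coroot_mx *m c^T.

Lemma root_comb_delta i : root_comb (delta_mx 0 i) = sroot D i.
Proof. by rewrite /root_comb -rowE rowK. Qed.

Lemma coroot_comb_delta i : coroot_comb (delta_mx 0 i) = scoroot D i.
Proof.
rewrite /coroot_comb trmx_delta -colE; apply/colP => j; by rewrite !mxE.
Qed.

Lemma root_comb_sum c : root_comb c = \sum_i c 0 i *: sroot D i.
Proof. by rewrite /root_comb mulmx_sum_row; apply: eq_bigr => i _; rewrite rowK. Qed.

Lemma coroot_combD c d : coroot_comb (c + d) = coroot_comb c + coroot_comb d.
Proof. by rewrite /coroot_comb linearD mulmxDr. Qed.

Lemma coroot_combZ k c : coroot_comb (k *: c) = k *: coroot_comb c.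
Proof. by rewrite /coroot_comb linearZ /= -scalemxAr. Qed.

Lemma coroot_combB c d : coroot_comb (c - d) = coroot_comb c - coroot_comb d.
Proof. by rewrite coroot_combD -scaleN1r coroot_combZ scaleN1r. Qed.

Lemma coroot_comb_sum c : coroot_comb c = \sum_i c 0 i *: scoroot D i.
Proof.
rewrite [in LHS](row_sum_delta c).
have E : {morph coroot_comb : x y / x + y} := coroot_combD.
rewrite (big_morph coroot_comb E (id1 := 0)); last first.
  by rewrite /coroot_comb linear0 mulmx0.
by apply: eq_bigr => i _; rewrite coroot_combZ coroot_comb_delta.
Qed.

Lemma root_comb_inj : injective root_comb.
Proof.
move=> c d h; apply/rowP => i; apply/eqP; rewrite -subr_eq0; apply/eqP.
apply: (@sroot_free _ _ _ D (fun i => c 0 i - d 0 i)).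
have : root_comb c - root_comb d = 0 by rewrite h subrr.
rewrite !root_comb_sum -sumrB => h0; rewrite -[RHS]h0.
by apply: eq_bigr => j _; rewrite scalerBl.
Qed.

Lemma coroot_comb_inj : injective coroot_comb.
Proof.
move=> c d h; apply/rowP => i; apply/eqP; rewrite -subr_eq0; apply/eqP.
apply: (@scoroot_free _ _ _ D (fun i => c 0 i - d 0 i)).
have : coroot_comb (c - d) = 0 by rewrite coroot_combB h subrr.
by rewrite coroot_comb_sum => h0; rewrite -[RHS]h0; apply: eq_bigr => j _; rewrite !mxE.
Qed.

(** The index convention makes the product the transpose of A, whence the symmetry. *)
Lemma root_coroot_mx : root_mx *m coroot_mx = A.
Proof.
rewrite -A_sym; apply/matrixP => i j; rewrite !mxE -(pairing_simple D) pairingE.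
by apply: eq_bigr => k _; rewrite !mxE.
Qed.

Lemma pairing_comb b c : pairing (root_comb b) (coroot_comb c) = gram b c.
Proof. by rewrite /root_comb pairing_mul mulmxA root_coroot_mx. Qed.

Definition simple_refl i : 'M[int]_r := 1%:M - scoroot D i *m sroot D i.

Lemma simple_refl_mulmx i y :
  simple_refl i *m y = y - pairing (sroot D i) y *: scoroot D i.
Proof. by rewrite mulmxBl mul1mx mulmx_pairing. Qed.

Lemma mulmx_simple_refl i b :
  b *m simple_refl i = b - pairing b (scoroot D i) *: sroot D i.
Proof. by rewrite mulmxBr mulmx1 mulmxA pairing_mulmx mul_scalar_mx. Qed.

Lemma simple_reflK i : simple_refl i *m simple_refl i = 1%:M.
Proof.
rewrite {2}/simple_refl mulmxBr mulmx1 mulmxA simple_refl_mulmx.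
rewrite pairing_simple A_diag scaler_nat mulr2n opprD addrA subrr add0r.
by rewrite mulNmx opprK /simple_refl subrK.
Qed.

Lemma weyl_simple i : weyl D (simple_refl i).
Proof. by rewrite -[simple_refl i]mulmx1; apply: weyl_step; apply: weyl_one. Qed.

Lemma weyl_unit w : weyl D w -> w \in unitmx.
Proof.
elim=> [|i {}w _ IH]; first exact: unitmx1.
by rewrite unitmx_mul IH andbT; have [] := mulmx1_unit (simple_reflK i).
Qed.

Lemma weyl_mul w w' : weyl D w -> weyl D w' -> weyl D (w *m w').
Proof.
by elim=> [|i {}w _ IH] hw'; rewrite ?mul1mx // -mulmxA; apply: weyl_step; exact: IH.
Qed.

Lemma invmx_simple_refl i w : w \in unitmx ->
  invmx (simple_refl i *m w) = invmx w *m simple_refl i.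
Proof.
move=> hw; have [hs _] := mulmx1_unit (simple_reflK i).
by rewrite invmx_mulmx // (invmx_uniq (simple_reflK i)).
Qed.

Lemma weyl_inv w : weyl D w -> weyl D (invmx w).
Proof.
elim=> [|i {}w hw IH]; first by rewrite invmx1; exact: weyl_one.
by rewrite invmx_simple_refl ?weyl_unit //; apply: weyl_mul => //; exact: weyl_simple.
Qed.

(** As A is symmetric, simple reflections act by the same formula on coordinates of roots and of
    coroots, and they preserve the form. *)
Lemma weyl_comb w c : weyl D w -> exists c',
  [/\ root_comb c *m invmx w = root_comb c',
      w *m coroot_comb c = coroot_comb c' & gram c' c' = gram c c].
Proof.
elim=> [|i {}w hw [c' [h1 h2 h3]]].
  by exists c; rewrite invmx1 mulmx1 mul1mx.
have dd : gram (delta_mx 0 i) (delta_mx 0 i) = 2.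
  by rewrite -pairing_comb root_comb_delta coroot_comb_delta pairing_simple.
exists (c' - gram (delta_mx 0 i) c' *: delta_mx 0 i); split.
- rewrite invmx_simple_refl ?weyl_unit // mulmxA h1 mulmx_simple_refl.
  rewrite -(coroot_comb_delta i) pairing_comb (gramC A_sym).
  by rewrite -(root_comb_delta i) /root_comb mulmxBl -scalemxAl.
- rewrite -mulmxA h2 simple_refl_mulmx -(root_comb_delta i) pairing_comb.
  by rewrite coroot_combB coroot_combZ coroot_comb_delta.
- rewrite gramBl !gramBr !gramZl !gramZr dd (gramC A_sym c') h3; ring.
Qed.

(** A root and its coroot share their coordinates, so the choice made in [coroot] depends on the
    root only. *)
Lemma coroot_spec b : real_root D b ->
  exists c, [/\ b = root_comb c, coroot D b = coroot_comb c & gram c c = 2].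
Proof.
case=> w hw [i bE].
have [w' hw' [j [bE' ->]]] : exists2 w, weyl D w &
    exists i, b = sroot D i *m invmx w /\ coroot D b = w *m scoroot D i.
  rewrite /coroot; case: xgetP => [y _ []|/(_ (w *m scoroot D i))] //.
    by move=> w' hw' [j [h1 h2]]; exists w' => //; exists j.
  by case; exists w => //; exists i.
have [c [h1 h2 h3]] := weyl_comb (delta_mx 0 j) hw'.
exists c; rewrite bE' -h1 -h2 root_comb_delta coroot_comb_delta; split=> //.
by rewrite h3 -pairing_comb root_comb_delta coroot_comb_delta pairing_simple.
Qed.

Lemma real_root_weyl b w : weyl D w -> real_root D b -> real_root D (b *m invmx w).
Proof.
move=> hw [w' hw' [i ->]]; exists (w *m w'); first exact: weyl_mul.
by exists i; rewrite invmx_mulmx ?weyl_unit // mulmxA.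
Qed.

Lemma coroot_weyl b w : weyl D w -> real_root D b ->
  coroot D (b *m invmx w) = w *m coroot D b.
Proof.
move=> hw hb; have [c [h1 -> _]] := coroot_spec hb.
have [c' [h1' -> _]] := weyl_comb c hw.
have [c'' [h1'' -> _]] := coroot_spec (real_root_weyl hw hb).
by congr coroot_comb; apply: root_comb_inj; rewrite -h1'' h1 h1'.
Qed.

Lemma pairing_coroot b : real_root D b -> pairing b (coroot D b) = 2.
Proof. by by case/coroot_spec=> c [h1 h2 <-]; rewrite h2 {1}h1 pairing_comb. Qed.

Lemma reflection_mulmx b y :
  reflection D b *m y = y - pairing b y *: coroot D b.
Proof. by rewrite mulmxBl mul1mx mulmx_pairing. Qed.

Lemma reflectionK b : real_root D b -> reflection D b *m reflection D b = 1%:M.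
Proof.
move=> hb; rewrite {2}/reflection mulmxBr mulmx1 mulmxA reflection_mulmx.
rewrite pairing_coroot // scaler_nat mulr2n opprD addrA subrr add0r.
by rewrite mulNmx opprK /reflection subrK.
Qed.

Lemma reflection_weyl b w : weyl D w -> real_root D b ->
  reflection D (b *m invmx w) = w *m reflection D b *m invmx w.
Proof.
move=> hw hb; rewrite /reflection coroot_weyl // mulmxBr mulmxBl mulmx1.
by rewrite mulmxV ?weyl_unit // !mulmxA.
Qed.

Lemma weyl_reflection b : real_root D b -> weyl D (reflection D b).
Proof.
case=> w hw [i ->].
have hi : real_root D (sroot D i).
  by exists 1%:M; [exact: weyl_one|exists i; rewrite invmx1 mulmx1].
have ci : coroot D (sroot D i) = scoroot D i.
  have [c [h1 -> _]] := coroot_spec hi.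
  by rewrite -(coroot_comb_delta i); congr coroot_comb; apply: root_comb_inj;
     rewrite root_comb_delta.
rewrite reflection_weyl // /reflection ci.
apply: weyl_mul; last exact: weyl_inv.
by apply: weyl_mul => //; exact: weyl_simple.
Qed.

Lemma mulmx_reflection b : real_root D b -> b *m reflection D b = - b.
Proof.
move=> hb; rewrite mulmxBr mulmx1 mulmxA pairing_mulmx pairing_coroot //.
by rewrite mul_scalar_mx scaler_nat mulr2n opprD addrA subrr add0r.
Qed.

(** The opposite root is the image under the root's own reflection. *)
Lemma real_rootN b : real_root D b -> real_root D (- b).
Proof.
move=> hb; rewrite -mulmx_reflection // -[in X in _ *m X](invmx_uniq (reflectionK hb)).
by apply: real_root_weyl => //; exact: weyl_reflection.
Qed.

Lemma corootN b : real_root D b -> coroot D (- b) = - coroot D b.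
Proof.
move=> hb; rewrite -mulmx_reflection // -[in X in _ *m X](invmx_uniq (reflectionK hb)).
rewrite coroot_weyl //; last exact: weyl_reflection.
by rewrite reflection_mulmx pairing_coroot // scaler_nat mulr2n opprD addrA subrr add0r.
Qed.

Lemma positive_root_coords c :
  positive_root D (root_comb c) -> forall i, 0 <= c 0 i.
Proof.
case=> _ [k hk] i.
suff -> : c = \row_j (k j)%:Z by rewrite mxE.
apply: root_comb_inj; rewrite hk root_comb_sum; apply: eq_bigr => j _.
by rewrite mxE -[in RHS]natz scaler_nat.
Qed.

(** A simple reflection subtracts the full height a, so [energyD] with m = - a has second factor a -
    a = 0. *)
Lemma weyl_orbit_energy w (lambda : 'cV[int]_r) : weyl D w -> exists c,
  w *m lambda = lambda + coroot_comb c /\ energy A (root_mx *m lambda) c = 0.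
Proof.
elim=> [|i {}w hw [c [h he]]].
  exists 0; rewrite mul1mx /coroot_comb linear0 mulmx0 addr0; split=> //.
  by rewrite /energy /pairing /gram /pairing !mul0mx mxE.
have dd : gram (delta_mx 0 i) (delta_mx 0 i) = 2.
  by rewrite -pairing_comb root_comb_delta coroot_comb_delta pairing_simple.
pose a := pairing (sroot D i) (w *m lambda).
have aE : a = height_at A (root_mx *m lambda) c (delta_mx 0 i).
  rewrite /a h pairingDr -{2}(root_comb_delta i) pairing_comb -root_comb_delta.
  by rewrite /root_comb pairing_mul.
exists (c - a *: delta_mx 0 i); split.
  by rewrite -mulmxA simple_refl_mulmx -/a coroot_combB coroot_combZ coroot_comb_delta h addrA.
rewrite -scaleNr energyD // he -aE; ring.
Qed.

End RootDatum.

(** * Local reflection groups and the effect of one Bruhat step *)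

Section LocalGroup.
Variables (n : nat) (A : 'M[int]_n) (r : nat) (D : root_datum A r).
Hypotheses (A_sym : A^T = A) (A_diag : forall i, A i i = 2).
Variable R : realType.
Implicit Types (x y z u v : aff r) (g h : affroot r).

Let wu := @weyl_unit _ _ _ D A_diag.

Lemma affine_reflE g : real_root D g.1 ->
  affine_refl D g = (reflection D g.1, - g.2 *: coroot D g.1).
Proof.
move=> hg; rewrite /affine_refl /amul /= mul1mx addr0.
rewrite (invmx_uniq (reflectionK A_sym A_diag hg)) reflection_mulmx.
rewrite pairingZr pairing_coroot // -scalerBl; congr (_, _ *: _); ring.
Qed.

Lemma iact_affine_refl g (w : 'cV[int]_r) : real_root D g.1 ->
  iact (affine_refl D g) w = w - (pairing g.1 w - g.2) *: coroot D g.1.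
Proof.
move=> hg; rewrite affine_reflE // /iact /= reflection_mulmx pairingDr pairingZr.
by rewrite pairing_coroot // -addrA -scalerBl -scaleNr; congr (_ + _ *: _); ring.
Qed.

Lemma affine_refl_weyl g : real_root D g.1 -> weyl D (affine_refl D g).1.
Proof. by move=> hg; rewrite affine_reflE //=; exact: weyl_reflection. Qed.

Lemma affine_refl_unit g : real_root D g.1 -> (affine_refl D g).1 \in unitmx.
Proof. by move=> hg; apply: wu; exact: affine_refl_weyl. Qed.

Lemma affine_reflK g : real_root D g.1 ->
  amul (affine_refl D g) (affine_refl D g) = aone r.
Proof.
move=> hg; rewrite affine_reflE // /amul /=.
rewrite (invmx_uniq (reflectionK A_sym A_diag hg)) reflectionK // reflection_mulmx.
rewrite pairingZr pairing_coroot //; congr (_, _).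
by rewrite -scalerBl -scalerDl -[RHS](scale0r (coroot D g.1)); congr (_ *: _); ring.
Qed.

Lemma affine_reflN g : real_root D g.1 ->
  affine_refl D (- g.1, - g.2) = affine_refl D g.
Proof.
move=> hg; have hN := real_rootN A_sym A_diag hg.
rewrite !affine_reflE //= /reflection corootN // mulNmx mulmxN opprK.
by rewrite scalerN scaleNr opprK.
Qed.

Lemma affine_refl_ract z g : weyl D z.1 -> real_root D g.1 ->
  amul z (affine_refl D g) = amul (affine_refl D (ract z g)) z.
Proof.
move=> hz hg; have hzg : real_root D (ract z g).1 by exact: real_root_weyl.
have zu := wu hz.
rewrite !affine_reflE // /amul /ract /= coroot_weyl // reflection_weyl //.
rewrite mulmxKV // (invmx_uniq (reflectionK A_sym A_diag hg)); congr (_, _).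
rewrite reflection_mulmx -scalemxAr mulKmx // [RHS]addrC -addrA; congr (_ + _).
by rewrite -scaleNr -scalerDl; congr (_ *: _); ring.
Qed.

Section Point.
Variables (lambda : 'cV[int]_r) (t : R).
Let p : 'cV[R]_r := t *: to_real R lambda.

Lemma Phi_atP g : Phi_at D p g <->
  real_root D g.1 /\ g.2%:~R = t * (pairing g.1 lambda)%:~R.
Proof.
have hE : real_root D g.1 -> aact (affine_refl D g) p =
    p - (t * (pairing g.1 lambda)%:~R - g.2%:~R) *: to_real R (coroot D g.1).
  move=> hg; rewrite /aact affine_reflE //= [reflection _ _ *m _]reflection_mulmx.
  rewrite pairingZr pairing_coroot // -scalerBl.
  rewrite /reflection map_mxB map_mx1 map_mxM mulmxBl mul1mx mulmx_pairing.
  rewrite /p pairingZr pairing_to_real /to_real map_mxZ -addrA; congr (_ + _).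
  rewrite -!scaleNr -scalerDl; congr (_ *: _).
  by rewrite rmorphB rmorphM rmorphN /=; ring.
rewrite /Phi_at /affine_root /=; split=> -[hg h]; split=> //; move: h; rewrite ?hE //.
- move=> /eqP; rewrite -subr_eq0 addrAC subrr add0r oppr_eq0 scaler_eq0.
  case/orP => [|/eqP h0]; first by rewrite subr_eq0 => /eqP.
  (* The coroot cannot vanish, as it pairs to 2 with its root. *)
  have := pairing_to_real R g.1 (coroot D g.1).
  rewrite h0 pairing_coroot // /pairing mulmx0 mxE => /esym/eqP.
  by rewrite intr_eq0.
- by move=> <-; rewrite subrr scale0r subr0.
Qed.

Lemma Phi_atN g : Phi_at D p g -> Phi_at D p (- g.1, - g.2).
Proof.
move=> /Phi_atP[hg h]; apply/Phi_atP; split; first exact: real_rootN.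
by rewrite /= pairingNl !rmorphN /= h mulrN.
Qed.

Lemma affine_negN g : affine_neg D (- g.1, - g.2) <-> affine_pos D g.
Proof. by case: g => b m; rewrite /affine_neg /= !opprK. Qed.

Lemma simple_at_real g : simple_at D p g -> real_root D g.1.
Proof. by case=> -[[]]. Qed.

Lemma word_weyl s : (forall g, g \in s -> simple_at D p g) ->
  weyl D (foldr (@amul r) (aone r) (map (affine_refl D) s)).1.
Proof.
elim: s => [|g s IH] hs /=; first exact: weyl_one.
apply: weyl_mul; last by apply: IH => h hh; apply: hs; rewrite inE hh orbT.
by apply: affine_refl_weyl; apply: simple_at_real; apply: hs; rewrite inE eqxx.
Qed.

(* Exchange: the first time a letter of the word turns [g] negative, that
   letter is the reflection in the current image of [g] and can be deleted. *)
Lemma exchange s g : (forall h, h \in s -> simple_at D p h) -> Phi_at_pos D p g ->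
  let u := foldr (@amul r) (aone r) (map (affine_refl D) s) in
  Phi_at_pos D p (ract u g) \/
  exists2 s', word_at D p s' (amul u (affine_refl D g)) & (size s' < size s)%N.
Proof.
move=> + hg; have hgr : real_root D g.1 by case: hg => -[].
elim: s => [|a s IH] hs /=.
  left; rewrite /ract /= invmx1 mulmx1 /pairing mulmx0 mxE addr0.
  by case: g hg {hgr}.
have hs' h : h \in s -> simple_at D p h by move=> hh; apply: hs; rewrite inE hh orbT.
have ha : simple_at D p a by apply: hs; rewrite inE eqxx.
have har := simple_at_real ha.
have hP := word_weyl hs'; set P := foldr _ _ _ in IH hP *.
case: (IH hs') => [hpos|[s1 [h1 h2] h3]].
  have [hE|hE] := pselect (ract P g = a).
    right; exists s => //; split=> //.
    rewrite amulA ?affine_refl_unit ?wu //.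
    rewrite affine_refl_ract // hE -amulA ?affine_refl_unit ?wu //.
    by rewrite affine_reflK // amul1x.
  left; rewrite ract_amul ?affine_refl_unit ?wu //.
  by case: ha => _; apply.
right; exists (a :: s1) => //; split.
  by move=> h; rewrite inE => /orP[/eqP ->|/h1].
by rewrite /= h2 amulA ?affine_refl_unit ?wu.
Qed.

(** Otherwise [exchange] deletes a letter from a reduced word of u and makes u s_g shorter than
    u. *)
Lemma longer_positive u g k m : Phi_at_pos D p g -> length_at D p u k ->
  length_at D p (amul u (affine_refl D g)) m -> (k < m)%N ->
  Phi_at_pos D p (ract u g).
Proof.
move=> hg [[s [hs <-] <-] _] [_ hm] km.
case: (exchange hs hg) => // -[s' /hm h1 h2].
by have := leq_ltn_trans h1 (ltn_trans h2 km); rewrite ltnn.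
Qed.

Lemma W_at_weyl u : W_at D p u -> weyl D u.1.
Proof.
elim=> [_ [g [hg _] <-]||v w _ hv _ hw|v _ hv] /=.
- exact: affine_refl_weyl.
- exact: weyl_one.
- exact: weyl_mul.
- exact: weyl_inv.
Qed.

(** A root b + n pi of [Phi_at] has n = t <b, lambda>, so orthogonality to lambda forces n = 0 and
    the reflection is linear. *)
Lemma W_germ_fix u : W_germ D lambda t u ->
  [/\ weyl D u.1, u.1 *m lambda = lambda & u.2 = 0].
Proof.
elim=> [_ [g [/Phi_atP[hg h] h0] <-]||v w _ [v1 v2 v3] _ [w1 w2 w3]|v _ [v1 v2 v3]].
- have -> : affine_refl D g = (reflection D g.1, 0).
    rewrite affine_reflE //; congr (_, _).
    move: h; rewrite h0 mulr0 => /eqP; rewrite intr_eq0 => /eqP ->.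
    by rewrite oppr0 scale0r.
  split=> //=; first exact: weyl_reflection.
  by rewrite reflection_mulmx h0 scale0r subr0.
- by rewrite /=; split; [exact: weyl_one|rewrite mul1mx|].
- by rewrite /=; split; [exact: weyl_mul|rewrite -mulmxA w2 v2|rewrite v3 w3 mulmx0 addr0].
- rewrite /=; split; [exact: weyl_inv| |by rewrite v3 mulmx0 oppr0].
  by rewrite -[in LHS]v2 mulKmx // wu.
Qed.

(** The last clause says that the affine root b + (<b, e> - m) pi is positive; it is the image under
    z of the root at t lambda used for the fold. *)
Definition fold_step z z' : Prop := exists b (m : int),
  let v := z.1 *m lambda in
  let e := iact z lambda in
  [/\ real_root D b, 0 < m, m%:~R = (1 - t) * (pairing b v)%:~R,
      z'.1 *m lambda = v - pairing b v *: coroot D b /\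
      iact z' lambda = e - m *: coroot D b &
      0 < pairing b e - m \/ (pairing b e - m = 0 /\ positive_root D b)].

(** Left multiplication by x y^{-1} carries a Bruhat chain starting at y to one starting at x. *)
Lemma bruhat_step_fold x y u v : 0 < t -> t < 1 -> weyl D x.1 -> is_bar D p x y ->
  bruhat_step D p u v ->
  let z w := amul x (amul (ainv y) w) in
  weyl D v.1 /\
  ((z v).1 *m lambda = (z u).1 *m lambda /\ iact (z v) lambda = iact (z u) lambda
   \/ fold_step (z u) (z v)).
Proof.
move=> t0 t1 hx [hy hbar] [/W_at_weyl hu [g0 hg0 vE] [k [m [hk hm km]]]] z.
have {}hy := W_at_weyl hy.
have hg0r : real_root D g0.1 by case: hg0.
split; first by rewrite vE; apply: weyl_mul => //; exact: affine_refl_weyl.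
have hyu : weyl D (amul (ainv y) u).1 by apply: weyl_mul => //; exact: weyl_inv.
have zE g : real_root D g.1 -> v = amul u (affine_refl D g) ->
    z v = amul (z u) (affine_refl D g).
  move=> hg ->; have hgu := wu (affine_refl_weyl hg).
  by rewrite /z !amulA ?affine_refl_unit ?wu.
have hz : weyl D (z u).1 by exact: weyl_mul.
(* If n = 0, then t > 0 makes the root orthogonal to lambda, and neither direction nor endpoint
   changes. *)
have [g20|g2] := eqVneq g0.2 0.
  have h0 : pairing g0.1 lambda = 0.
    case/Phi_atP: hg0 => _; rewrite g20 => /esym/eqP.
    by rewrite mulf_eq0 (gt_eqF t0) intr_eq0 => /eqP.
  left; rewrite (zE g0) //; split.
    by rewrite affine_reflE //= -mulmxA reflection_mulmx h0 scale0r subr0.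
  rewrite iact_amul ?affine_refl_unit ?wu // iact_affine_refl //.
  by rewrite h0 g20 subrr scale0r subr0.
(* The sign is chosen with n > 0: then g is a positive affine root and <b, lambda> = n / t > 0. *)
have [g [hg hgr vE' g2']] : exists g, [/\ Phi_at D p g, real_root D g.1,
    v = amul u (affine_refl D g) & 0 < g.2].
  case: (ltrgt0P g0.2) => h; [by exists g0| |by rewrite h eqxx in g2].
  exists (- g0.1, - g0.2); rewrite (affine_reflN hg0r).
  split; [exact: Phi_atN|exact: real_rootN|exact: vE|by rewrite oppr_gt0].
right.
have gpos : Phi_at_pos D p g by split=> //; split=> //; left.
have hm' : length_at D p (amul u (affine_refl D g)) m by rewrite -vE'.
have [hP1 hP2] := longer_positive gpos hk hm' km.
(* For G = y^{-1} u g the root y G = u g is positive; the defining property of the bar, applied to -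
   G, makes x G positive as well. *)
have zpos : affine_pos D (ract (z u) g).
  pose G := ract (amul (ainv y) u) g.
  have yG : ract y G = ract u g.
    rewrite /G -ract_amul ?wu // -amulA ?wu //; last exact: weyl_inv.
    by rewrite amulxV ?wu // amul1x.
  have xG : ract x G = ract (z u) g by rewrite /G -ract_amul ?wu.
  have yN : (ract y @^-1` Phi_at_neg D p) (- G.1, - G.2).
    change (Phi_at_neg D p (ract y (- G.1, - G.2))).
    by rewrite ractN yG; split; [exact: Phi_atN|apply/affine_negN].
  move: yN; rewrite -hbar => -[xN _]; move: xN.
  change (affine_neg D (ract x (- G.1, - G.2)) -> affine_pos D (ract (z u) g)).
  by rewrite ractN xG => /affine_negN.
case/Phi_atP: hg => _ hg2.
have [a0 ta] : 0 < pairing g.1 lambda /\ g.2%:~R = t * (pairing g.1 lambda)%:~R.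
  split=> //; rewrite -(ltr0z R) -(pmulr_rgt0 _ t0) -hg2 ltr0z //.
have pv : pairing (ract (z u) g).1 ((z u).1 *m lambda) = pairing g.1 lambda.
  by rewrite /ract /= pairing_mul mulKmx // wu.
have pe : pairing (ract (z u) g).1 (iact (z u) lambda) =
    pairing g.1 lambda + pairing g.1 (z u).2.
  by rewrite /ract /iact /= pairing_mul mulKmx ?wu // pairingDr.
exists (ract (z u) g).1, (pairing g.1 lambda - g.2); split.
- by case: zpos.
- rewrite -(ltr0z R) rmorphB /= hg2.
  have : 0 < (pairing g.1 lambda)%:~R :> R by rewrite ltr0z.
  by rewrite -{2}[_%:~R]mul1r -mulrBl => h; rewrite mulr_gt0 // subr_gt0.
- by rewrite pv rmorphB /= hg2; ring.
- rewrite pv (zE g) //; split.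
    rewrite affine_reflE //= -mulmxA reflection_mulmx mulmxBr -scalemxAr.
    by rewrite coroot_weyl.
  rewrite iact_amul ?affine_refl_unit ?wu // iact_affine_refl //.
  rewrite /iact coroot_weyl // addrAC mulmxBr -scalemxAr; congr (_ - _ *: _).
- rewrite pe; case: zpos => _; rewrite /ract /=.
  have -> : pairing g.1 lambda + pairing g.1 (z u).2 - (pairing g.1 lambda - g.2) =
     g.2 + pairing g.1 (z u).2 by ring.
  by [].
Qed.

End Point.
End LocalGroup.

(** * From Hecke paths to chains *)

Section Paths.
Variables (n : nat) (A : 'M[int]_n) (r : nat) (D : root_datum A r).
Hypotheses (A_sym : A^T = A) (A_diag : forall i, A i i = 2).
Variables (R : realType) (lambda : 'cV[int]_r).

Let eta := root_mx D *m lambda.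
Let wt (c : 'rV[int]_n) := lambda + coroot_comb D c.
Let last_fold (s : seq (state R n)) : state R n := head (0, 0, 0) s.

Definition encodes (y : state R n) (z : aff r) : Prop :=
  z.1 *m lambda = wt y.1.2 /\ iact z lambda = wt y.2.

Lemma pairing_wt b c : pairing (root_comb D b) (wt c) = height_at A eta c b.
Proof. by rewrite pairingDr pairing_comb // /root_comb pairing_mul. Qed.

Lemma chain_fold_step t z z' y s : chain A eta (y :: s) -> encodes y z ->
  fold_step D lambda t z z' -> exists y',
  [/\ chain A eta (y' :: y :: s), y'.1.1 = t & encodes y' z'].
Proof.
case: y => -[t' u] c hs [/= zu zc] [b [m []]]; rewrite zu zc.
move=> hb m0 mt [zu' zc'] hpos.
have [d [dE cdE dd]] := coroot_spec A_sym A_diag hb.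
rewrite cdE dE !pairing_wt in mt zu' zc' hpos.
exists (t, u - height_at A eta u d *: d, c - m *: d); split=> //; last first.
  by split; rewrite /= ?zu' ?zc' /wt coroot_combB coroot_combZ addrA.
(* The constructor [chain_fold] expresses the old endpoint through the new one. *)
have cE : c = c - m *: d + m *: d by rewrite subrK.
rewrite [in X in _ :: X]cE; apply: chain_fold; rewrite -?cE //; split=> //.
have -> : height_at A eta (c - m *: d) d + m = height_at A eta c d - m.
  by rewrite -scaleNr height_atD dd; ring.
case: hpos => [|[h0 hd]]; [by left|right; split=> //].
exact: positive_root_coords hd.
Qed.

Lemma chain_bruhat t x y u v s : 0 < t -> t < 1 -> weyl D x.1 ->
  is_bar D (t *: to_real R lambda) x y ->
  bruhat D (t *: to_real R lambda) u v ->
  chain A eta s -> encodes (last_fold s) (amul x (amul (ainv y) u)) ->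
  exists s1, [/\ chain A eta (s1 ++ s), all (fun y => y.1.1 == t) s1 &
    encodes (last_fold (s1 ++ s)) (amul x (amul (ainv y) v))].
Proof.
move=> t0 t1 hx hbar huv.
elim: huv s => {u v} [u v huv|u|u v w _ IH1 _ IH2] s hs henc.
- have [_ [[e1 e2]|hf]] := bruhat_step_fold A_sym A_diag t0 t1 hx hbar huv.
    by exists [::]; split=> //; rewrite /encodes e1 e2.
  case: s hs henc => [h|y0 s hs henc]; first by inversion h.
  have [y' [h1 h2 h3]] := chain_fold_step hs henc hf.
  by exists [:: y']; rewrite /= h2 eqxx; split.
- by exists [::].
- have [s1 [c1 a1 e1]] := IH1 s hs henc.
  have [s2 [c2 a2 e2]] := IH2 _ c1 e1.
  by exists (s2 ++ s1); rewrite -!catA all_cat a1 a2.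
Qed.

(** Minimal representatives differ from the given elements by right factors in [W_germ], which fix
    lambda and do not affect [encodes]. The chain then runs from x to x y^{-1} y x^{-1} x' = x'. *)
Lemma chain_quotient t x x' y s : 0 < t -> t < 1 -> weyl D x.1 -> weyl D x'.1 ->
  is_bar D (t *: to_real R lambda) x y ->
  quotient_le D (t *: to_real R lambda) (W_germ D lambda t) y
    (amul y (amul (ainv x) x')) ->
  chain A eta s -> encodes (last_fold s) x ->
  exists s1, [/\ chain A eta (s1 ++ s), all (fun y => y.1.1 == t) s1 &
    encodes (last_fold (s1 ++ s)) x'].
Proof.
move=> t0 t1 hx hx' hbar [mu [mv [[[p1 hp1 ->] _] [[p2 hp2 ->] _] hb]]] hs henc.
have wu := @weyl_unit _ _ _ D A_diag.
have [hp1w hp1l hp1z] := W_germ_fix A_sym A_diag hp1.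
have [hp2w hp2l hp2z] := W_germ_fix A_sym A_diag hp2.
have hy : weyl D y.1 by case: hbar => /(W_at_weyl A_sym A_diag).
have encP z q y0 : weyl D q.1 -> q.1 *m lambda = lambda -> q.2 = 0 ->
    encodes y0 (amul z q) <-> encodes y0 z.
  move=> hq ql q2; rewrite /encodes iact_amul ?wu //= -mulmxA ql.
  by rewrite {2}/iact q2 addr0 ql.
have e1 : amul x (amul (ainv y) (amul y p1)) = amul x p1.
  by rewrite -(amulA (ainv y)) ?wu // amulVx ?wu // amul1x.
have hd : weyl D (amul (ainv x) x').1 by apply: weyl_mul => //; exact: weyl_inv.
have e2 : amul x (amul (ainv y) (amul (amul y (amul (ainv x) x')) p2)) = amul x' p2.
  rewrite (amulA y) ?wu // -(amulA (ainv y)) ?wu //; last exact: weyl_mul.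
  rewrite amulVx ?wu // amul1x -amulA ?wu // -(amulA x) ?wu //; last exact: weyl_inv.
  by rewrite amulxV ?wu // amul1x.
have henc' : encodes (last_fold s) (amul x (amul (ainv y) (amul y p1))).
  by rewrite e1; apply/encP.
have [s1 [h1 h2 h3]] := chain_bruhat t0 t1 hx hbar hb hs henc'.
by exists s1; split=> //; move: h3; rewrite e2 => /encP; apply.
Qed.

(* Chains list the latest fold first, so the head of the filtered list is the
   state that is current at time [q]. *)
Definition path_at (s : seq (state R n)) (q : R) : 'cV[R]_r :=
  let y := last_fold [seq y <- s | y.1.1 <= q] in
  to_real R (wt y.2) - (1 - q) *: to_real R (wt y.1.2).

(** An affine map with direction v and endpoint e sends q lambda to e - (1 - q) v. *)
Lemma path_at_encodes y s z q : y.1.1 <= q -> encodes y z ->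
  path_at (y :: s) q = aact z (q *: to_real R lambda).
Proof.
move=> yq [e1 e2]; rewrite /path_at /= yq /= -e1 -e2 /aact /iact.
rewrite mulmxDr /to_real map_mxD !map_mxM -scalemxAr scalerBl scale1r opprB.
by rewrite addrCA [X in _ + X]addrAC subrr add0r.
Qed.

Lemma hecke_path_chain (nu : 'cV[int]_r) tau : hecke_paths D R lambda nu tau ->
  exists s, [/\ chain A eta s, wt (last_fold s).2 = nu &
    tau = fun q => path_at s (sval q)].
Proof.
case=> N [t [x [[t0 tN t_lt] [hx x0] htau hend hfold]]].
have t_mono i j : (i < j)%N -> (j <= N.+1)%N -> t i < t j.
  elim: j => // j IH; rewrite ltnS leq_eqVlt => /orP[/eqP ->|ij] hj; first exact: t_lt.
  exact: lt_trans (IH ij (ltnW hj)) (t_lt j hj).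
have ht1 k : (k <= N)%N -> t k < 1 by move=> hk; rewrite -tN; exact: t_mono.
have hw k : (k <= N)%N -> weyl D (x k).1 by case/hx.
(* Invariant: the chain encodes x_k, its latest fold is no later than t_k, and it describes the path
   up to t_{k+1}. *)
suff H k : (k <= N)%N -> exists y s, [/\ chain A eta (y :: s), encodes y (x k),
    y.1.1 <= t k & forall q : {q : R | 0 <= q <= 1}, sval q <= t k.+1 ->
      tau q = path_at (y :: s) (sval q)].
  have [y [s [h1 [_ h2] _ h3]]] := H N (leqnn N).
  exists (y :: s); split=> //.
    by rewrite /= -h2; apply: (@to_real_inj _ R); rewrite -hend aact_to_real.
  by apply/funext => q; apply: h3; rewrite tN; case: q => q /= /andP[].
elim: k => [|k IH] hk.
  have [c [cE ce]] := weyl_orbit_energy A_sym A_diag lambda (hw 0%N isT).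
  have enc : encodes (0, c, c) (x 0%N) by split; rewrite /= ?/iact ?x0 ?addr0.
  exists (0, c, c), [::]; split=> //; first exact: chain_start.
    by rewrite t0.
  case=> q hq /= qt; rewrite (path_at_encodes _ _ enc) /=; last by case/andP: hq.
  by rewrite (htau 0%N isT) //= t0 qt andbT; case/andP: hq.
have [y [s [h1 h2 h3 h4]]] := IH (ltnW hk).
have /= [_ [y' hbar hle] _] := hfold k hk.
have tk0 : 0 < t k.+1 by rewrite -t0; apply: t_mono => //; exact: ltnW.
have [s1 [c1 a1 e1]] := chain_quotient tk0 (ht1 _ hk) (hw _ (ltnW hk)) (hw _ hk)
  hbar hle h1 h2.
have [y1 [s2 sE y1t]] : exists y1, exists2 s2, s1 ++ y :: s = y1 :: s2 & y1.1.1 <= t k.+1.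
  case: s1 a1 {c1 e1} => [|y1 s1] /=.
    by exists y, s => //; apply: le_trans h3 (ltW (t_lt k (ltnW hk))).
  by case/andP=> /eqP h _; exists y1, (s1 ++ y :: s); rewrite ?h.
exists y1, s2; rewrite -sE; split=> //; first by rewrite sE in e1.
move=> q hq; have [tq|qt] := lerP (t k.+1) (sval q).
  rewrite sE in e1 *; rewrite (path_at_encodes _ (le_trans y1t tq) e1).
  by apply: htau => //; rewrite tq.
(* Before t_{k+1} the filter drops all new states, so the earlier description persists. *)
rewrite h4 ?ltW //; rewrite /path_at filter_cat.
rewrite (@eq_in_filter _ _ pred0 s1) ?filter_pred0 // => y0 /(allP a1) /eqP ->.
by rewrite leNgt qt.
Qed.

End Paths.

Theorem theorem5p54 (R : realType) (l r : nat) (C : 'M[int]_l)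
    (theta : 'rV[int]_l) (hC : type_ADE C) (htheta : highest_root C theta)
    (D : root_datum (affinization C theta) r) (lambda nu : 'cV[int]_r)
    (lambda_dom : dominant D lambda) (lambda_level : 0 < level D lambda)
    (nu_dom : dominant D nu) (nu_level : 0 < level D nu) :
  finite_set (hecke_paths D R lambda nu).
Proof.
have A_sym := affinization_sym theta hC; have A_diag := affinization_diag theta hC.
pose eta := root_mx D *m lambda.
have level_gt0 : 0 < pairing (null_root theta) eta.
  move: lambda_level; rewrite /level /imaginary_root -pairing_mul.
  rewrite -[_ *m root_mx D]/(root_comb D _) root_comb_sum big_split_ord /= big_ord1.
  rewrite [null_root theta 0 _]row_mxEl mxE eqxx scale1r.
  by under [X in _ -> 0 < pairing (_ + X) _]eq_bigr do rewrite row_mxEr.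
have fin := finite_chains_to R A_sym
  (bounded_roots hC htheta level_gt0) (bounded_above hC htheta level_gt0).
(* Chains end in the coset of lambda modulo the coroot lattice; for nu outside it there are no
   paths. *)
have [[c cE]|hc] := pselect (exists c, lambda + coroot_comb D c = nu); last first.
  rewrite (_ : hecke_paths _ _ _ _ = set0) ?finite_set0 //; apply/seteqP; split=> // tau.
  by move=> /(hecke_path_chain A_sym A_diag)[s [_ h _]]; apply: hc; eexists; exact: h.
apply: sub_finite_set (finite_image (fun s q => path_at D lambda s (sval q)) (fin c)).
move=> tau /(hecke_path_chain A_sym A_diag)[s [h1 h2 ->]]; exists s => //; split=> //.
apply: (@coroot_comb_inj _ _ _ D); apply: (addrI lambda).
by rewrite cE -h2.
Qed.
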